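(* Let $k,p$ be positive real numbers, $n\in\mathbb{N}$, $n\ge1$, and $x\in\mathbb{C}\setminus k\mathbb{Z}^{-}$ with $\mathrm{Re}(x)>0$. Then the following identities hold (each for those $x$ for which every p-k Gamma value occurring in it is defined): $${}_{p}(x)_{n,k}=\frac{{}_{p}\Gamma_{k}(x+nk)}{{}_{p}\Gamma_{k}(x)},$$ $${}_{p}\Gamma_{k}(x+k)=\frac{xp}{k}\;{}_{p}\Gamma_{k}(x),$$ $${}_{p}\Gamma_{k}(x+nk)=p^{n}\left(\frac{x}{k}\right)\left(\frac{x}{k}+1\right)\cdots\left(\frac{x}{k}+(n-1)\right){}_{p}\Gamma_{k}(x),$$ $$\frac{{}_{p}\Gamma_{k}(x)}{{}_{p}\Gamma_{k}(x-nk)}=\frac{p^{n}}{k^{n}}(x-k)(x-2k)\cdots(x-nk),$$ $$\frac{{}_{p}\Gamma_{k}(x)}{{}_{p}\Gamma_{k}(x-nk)}=(-1)^{n}\,\frac{{}_{p}\Gamma_{k}(-x+nk+k)}{{}_{p}\Gamma_{k}(-x+k)},$$ $${}_{p}\Gamma_{k}(1)=\frac{p^{\frac1k}}{k}\,\Gamma\left(\frac1k\right),\qquad {}_{p}\Gamma_{k}(k)=\frac{p}{k},\qquad {}_{p}\Gamma_{k}(p)=\frac{p^{\frac{p}{k}}}{k}\,\Gamma\left(\frac{p}{k}\right),$$ $${}_{p}\Gamma_{k}(x)\;{}_{p}\Gamma_{k}(-x)=-\frac{\pi}{xk}\,\frac{1}{\sin\left(\frac{\pi x}{k}\right)},$$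 $${}_{p}\Gamma_{k}(x)\;{}_{p}\Gamma_{k}(k-x)=\frac{p}{k^{2}}\,\frac{\pi}{\sin\left(\frac{\pi x}{k}\right)},$$ $$\prod_{r=0}^{m-1}{}_{p}\Gamma_{k}\left(x+\frac{kr}{m}\right)=\frac{p^{\frac{m-1}{2}}}{k^{m-1}}(2\pi)^{\frac{m-1}{2}}\,m^{\frac12-\frac{mx}{k}}\;{}_{p}\Gamma_{k}(mx)\qquad\text{for } m=2,3,4,\dots$$
   Context: $\mathbb{Z}^-$ is the set of negative integers and $\Gamma$ is the classical Gamma function. The p-k Pochhammer symbol is ${}_{p}(z)_{n,k}=\left(\frac{zp}{k}\right)\left(\frac{zp}{k}+p\right)\cdots\left(\frac{zp}{k}+(n-1)p\right)$ for $z\in\mathbb{C}$. The p-k Gamma function is $${}_{p}\Gamma_{k}(z)=\frac1k\lim_{n\to\infty}\frac{n!\,p^{n+1}(np)^{z/k}}{{}_{p}(z)_{n+1,k}}=\frac1k\lim_{n\to\infty}\frac{n!\,p^{n+1}(np)^{\frac{z}{k}-1}}{{}_{p}(z)_{n,k}},$$ defined by this limit for every $z\in\mathbb{C}\setminus\{0,-k,-2k,\dots\}$. For a positive real base $c$, $c^{z}=e^{z\ln c}$. *)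

(* Defs.v *)
From Stdlib Require Import Reals Factorial.
From Coquelicot Require Import Coquelicot.

Local Open Scope C_scope.

Definition Cexp (z : C) : C :=
  ((exp (Re z) * cos (Im z))%R, (exp (Re z) * sin (Im z))%R).

Definition Csin (z : C) : C := (Cexp (Ci * z) - Cexp (- (Ci * z))) / (2 * Ci).

(* Only meant for a base [c > 0]: outside, [ln] takes a junk value. *)
Definition Cpower (c : R) (z : C) : C := Cexp (z * ln c).

(* f 0 * ... * f (n - 1) *)
Fixpoint Cprod (f : nat -> C) (n : nat) : C :=
  match n with
  | O => 1
  | S n' => Cprod f n' * f n'
  end.

(* Like [RInt] or [Lim], this is total; the value is meaningful when the
   sequence converges. *)
Definition Clim_seq (u : nat -> C) : C :=
  iota (fun l : C_CompleteNormedModule => filterlim u eventually (locally l)).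

(* Euler's integral, for real [s > 0]. *)
Definition Gamma (s : R) : R :=
  RInt_gen (fun t : R => (Rpower t (s - 1) * exp (- t))%R)
    (at_right 0%R) (Rbar_locally p_infty).

Definition pk_pochhammer (p k : R) (z : C) (n : nat) : C :=
  Cprod (fun i => z * p / k + INR i * p) n.

(* The term at [n = 0] involves [ln 0] and is irrelevant to the limit. *)
Definition pk_Gamma_seq (p k : R) (z : C) (n : nat) : C :=
  INR (fact n) * (p ^ (n + 1))%R * Cpower (INR n * p) (z / k)
    / pk_pochhammer p k z (n + 1).

Definition pk_Gamma (p k : R) (z : C) : C :=
  1 / k * Clim_seq (pk_Gamma_seq p k z).

(* The domain of [pk_Gamma p k]: the points outside {0, -k, -2k, ...}. *)
Definition pk_Gamma_dom (k : R) (z : C) : Prop :=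
  forall j : nat, z <> - (INR j * k).

(* Main.v *)
(** Dividing Gauss' products by powers of [p] gives [pk_Gamma p k z = p^(z/k) / k * G (z / k)],
    where [G z] is the limit of [n! n^z / (z (z + 1) ... (z + n))], so every identity is a
    classical one for [G].  The limit exists and is nonzero since consecutive ratios are
    [1 + O(1/n^2)].  Reflection follows from the product for [sin (PI z)], read off
    the moments [J n] of [exp (2 i z t) (cos t)^n] over [-PI/2, PI/2]: integration by parts gives
    [n (n - 1) J (n - 2) = (n^2 - 4 z^2) J n], and the moments with and without the factor
    [exp (2 i z t)] are asymptotically equal.  The multiplication formula holds for Gauss'
    products up to a quotient of factorials, evaluated by Stirling's formula, whose constant
    [sqrt (2 PI)] comes from reflection at [1/2].  For Euler's integral, integrate by parts [n + 1]
    times and squeeze [(t / n)^s], for [1 <= s <= 2], between polynomials in [t / n]. *)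
Require Import Defs.
From Stdlib Require Import Reals.
From Coquelicot Require Import Coquelicot.
From Stdlib Require Import Factorial Lra Lia Psatz.
Open Scope C_scope.

(** * Limits of complex sequences *)

(** Euler's integral enters only in the values at [1] and [p]. As [Gamma] is an [RInt_gen], its
    convergence has to be established together with its value; hence the squeeze is applied to
    integrals over [[a, b]], with [n] fixed before the endpoints move. After the integrations by
    parts the density [t^n exp(-t) / n!] is concentrated near [t = n], so [t^s] behaves like [n^s],
    which is the power in Gauss' product. The powers of the cosine concentrate at [t = 0], where
    [exp (2 i z t)] is [1]: this is why the two kinds of moments agree asymptotically. Iterating the
    recurrence down to index [0] writes [sin (PI z) / (PI z)] as a finite product times a ratio
    tending to [1]. That finite product cancels against the Gauss products before any limit is
    taken, so no infinite product has to be handled. Circularity between Stirling's constant and the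
    multiplication formula is avoided by proving the latter with an unknown limit [s]; its case
    [m = 2], [z = 1/2] then determines [s]. Nonvanishing of the limit matters because quotients of
    Gamma values can be cancelled only with a nonzero denominator. *)

Lemma C_eq (a b : C) : Re a = Re b -> Im a = Im b -> a = b.
Proof. destruct a, b; simpl; intros -> ->; reflexivity. Qed.

Lemma Cmod_le_abs (z : C) : (Cmod z <= Rabs (Re z) + Rabs (Im z))%R.
Proof.
replace z with (RtoC (Re z) + RtoC (Im z) * Ci) at 1
  by (apply C_eq; simpl; ring).
eapply Rle_trans; [apply Cmod_triangle|].
rewrite Cmod_mult, Cmod_Ci, !Cmod_R. lra.
Qed.

Lemma im_le_Cmod (z : C) : (Rabs (Im z) <= Cmod z)%R.
Proof. eapply Rle_trans; [apply Rmax_r|apply Rmax_Cmod]. Qed.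

Lemma Cmod_minus_sym (a b : C) : Cmod (a - b) = Cmod (b - a).
Proof. rewrite <- Cmod_opp. f_equal. ring. Qed.

Lemma Cmod_triangle_rev (a b : C) : (Cmod a - Cmod b <= Cmod (a + b))%R.
Proof.
generalize (Cmod_triangle (a + b) (- b)). rewrite Cmod_opp.
replace (a + b + - b) with a by ring. lra.
Qed.

Lemma exp_le_exp (a b : R) : (a <= b)%R -> (exp a <= exp b)%R.
Proof. intros [H| ->]; [left; apply exp_increasing, H|apply Rle_refl]. Qed.

(** Convergence by components makes the lemmas on real sequences applicable; [is_Clim_filterlim]
    links it to the filter limit inside [Clim_seq]. *)
Definition is_Clim (u : nat -> C) (l : C) : Prop :=
  is_lim_seq (fun n => Re (u n)) (Re l) /\ is_lim_seq (fun n => Im (u n)) (Im l).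

Lemma is_Clim_filterlim u l : is_Clim u l ->
  filterlim u eventually (@locally C_CompleteNormedModule l).
Proof.
intros [H1 H2] P [eps HP].
apply is_lim_seq_spec in H1. apply is_lim_seq_spec in H2.
destruct (H1 eps) as [N1 h1]. destruct (H2 eps) as [N2 h2].
exists (max N1 N2). intros n Hn. apply HP.
split; [apply h1|apply h2]; lia.
Qed.

Lemma Clim_seq_unique u l : is_Clim u l -> Clim_seq u = l.
Proof.
intros H. apply (iota_filterlim_locally (V:=C_CompleteNormedModule)), is_Clim_filterlim, H.
Qed.

Lemma is_Clim_le u l (e : nat -> R) :
  eventually (fun n => (Cmod (u n - l) <= e n)%R) -> is_lim_seq e 0%R -> is_Clim u l.
Proof.
intros [N H] He.
assert (G : forall f : nat -> R, (forall n, (N <= n)%nat -> (Rabs (f n) <= e n)%R) ->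
  is_lim_seq f 0%R).
{ intros f Hf. apply is_lim_seq_abs_0.
  apply is_lim_seq_le_le_loc with (fun _ => 0%R) e; [|apply is_lim_seq_const|exact He].
  exists N; intros n Hn. split; [apply Rabs_pos|auto]. }
assert (T : forall (f : nat -> R) c, is_lim_seq (fun n => (f n - c)%R) 0%R -> is_lim_seq f c).
{ intros f c Hf. apply is_lim_seq_ext with (fun n => ((f n - c) + c)%R); [intros; ring|].
  replace (Finite c) with (Finite (0 + c)%R) by (f_equal; ring).
  apply is_lim_seq_plus'; [exact Hf|apply is_lim_seq_const]. }
split; apply T, G; intros n Hn; (eapply Rle_trans; [|apply (H n Hn)]).
- apply (re_le_Cmod (u n - l)).
- apply (im_le_Cmod (u n - l)).
Qed.

Lemma is_Clim_unique u l l' : is_Clim u l -> is_Clim u l' -> l = l'.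
Proof. intros H H'. rewrite <- (Clim_seq_unique _ _ H). apply Clim_seq_unique, H'. Qed.

Lemma is_Clim_const c : is_Clim (fun _ => c) c.
Proof. split; apply is_lim_seq_const. Qed.

(** The starting index lets the term at [n = 0], where [ln 0] occurs, be ignored. *)
Lemma is_Clim_ext_from N u v l : (forall n, (N <= n)%nat -> u n = v n) ->
  is_Clim u l -> is_Clim v l.
Proof.
intros H [H1 H2]. split; (eapply is_lim_seq_ext_loc; [|eassumption]); exists N;
  intros n Hn; rewrite (H n Hn); reflexivity.
Qed.

Lemma is_Clim_plus u v a b : is_Clim u a -> is_Clim v b ->
  is_Clim (fun n => u n + v n) (a + b).
Proof. intros [? ?] [? ?]; split; apply is_lim_seq_plus'; assumption. Qed.

Lemma is_Clim_mult u v a b : is_Clim u a -> is_Clim v b ->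
  is_Clim (fun n => u n * v n) (a * b).
Proof.
intros [? ?] [? ?]; split; [apply is_lim_seq_minus'|apply is_lim_seq_plus'];
  apply is_lim_seq_mult'; assumption.
Qed.

Lemma Cnorm2_neq_0 (l : C) : l <> 0 -> (Re l ^ 2 + Im l ^ 2)%R <> 0%R.
Proof.
intros Hl E. apply Hl, Cmod_eq_0.
assert (H : (Cmod l ^ 2)%R = 0%R).
{ unfold Cmod. rewrite pow2_sqrt; [exact E|]. nra. }
nra.
Qed.

Lemma is_Clim_inv u l : is_Clim u l -> l <> 0 -> is_Clim (fun n => / u n) (/ l).
Proof.
intros [H1 H2] Hl.
assert (D : is_lim_seq (fun n => (Re (u n) ^ 2 + Im (u n) ^ 2)%R) (Re l ^ 2 + Im l ^ 2)%R).
{ simpl. apply is_lim_seq_plus'; repeat apply is_lim_seq_mult';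
  try assumption; apply is_lim_seq_const. }
split; apply is_lim_seq_div'; try apply Cnorm2_neq_0; try assumption.
simpl. apply (is_lim_seq_opp _ (Finite (Im l))), H2.
Qed.

Lemma is_Clim_subseq (phi : nat -> nat) u l :
  (forall N, exists M, forall n, (M <= n)%nat -> (N <= phi n)%nat) ->
  is_Clim u l -> is_Clim (fun n => u (phi n)) l.
Proof.
intros Hphi [H1 H2].
assert (F : filterlim phi eventually eventually).
{ intros P [N HN]. destruct (Hphi N) as [M HM]. exists M. intros n Hn. auto. }
split; [apply (is_lim_seq_subseq (fun n => Re (u n)))|apply (is_lim_seq_subseq (fun n => Im (u n)))];
  assumption.
Qed.

Lemma is_Clim_Cprod (f : nat -> nat -> C) (l : nat -> C) m :
  (forall r, (r < m)%nat -> is_Clim (fun n => f n r) (l r)) ->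
  is_Clim (fun n => Cprod (f n) m) (Cprod l m).
Proof.
induction m; simpl; intros H; [apply is_Clim_const|].
apply is_Clim_mult; [apply IHm; auto|apply H; lia].
Qed.

Lemma is_lim_seq_div_INR (c : R) : is_lim_seq (fun n => (c / INR n)%R) 0%R.
Proof.
replace 0%R with (c * 0)%R by ring.
apply (is_lim_seq_mult' (fun _ => c) (fun n => (/ INR n)%R)).
- apply is_lim_seq_const.
- apply (is_lim_seq_inv _ p_infty); [apply is_lim_seq_INR|discriminate].
Qed.

Lemma is_Clim_RtoC (f : nat -> R) (l : R) : is_lim_seq f l -> is_Clim (fun n => RtoC (f n)) l.
Proof. intros H; split; [exact H|apply is_lim_seq_const]. Qed.

Lemma ex_Clim_cauchy (u : nat -> C) (M : R) N :
  (forall n m, (N <= n)%nat -> (n <= m)%nat -> (Cmod (u m - u n) <= M / INR n)%R) ->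
  exists l, is_Clim u l.
Proof.
intros H.
assert (G : forall f : C -> R, (forall z, (Rabs (f z) <= Cmod z)%R) ->
   (forall a b, f (a - b) = (f a - f b)%R) -> exists l : R, is_lim_seq (fun n => f (u n)) l).
{ intros f Hf Hlin.
  assert (E : ex_finite_lim_seq (fun n => f (u n))); [|exact E].
  apply ex_lim_seq_cauchy_corr. intros eps.
  generalize (is_lim_seq_div_INR M). intros L. apply is_lim_seq_spec in L.
  destruct (L eps) as [N1 L1]. exists (max N N1).
  assert (K : forall n m, (max N N1 <= n)%nat -> (n <= m)%nat ->
    (Rabs (f (u m) - f (u n)) < eps)%R).
  { intros n m Hn Hm. rewrite <- Hlin. eapply Rle_lt_trans; [apply Hf|].
    eapply Rle_lt_trans; [apply H; lia|].
    generalize (L1 n ltac:(lia)). rewrite Rminus_0_r. intros HH.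
    apply Rabs_lt_between in HH. lra. }
  intros n m Hn Hm. destruct (Nat.le_ge_cases n m) as [h|h].
  - rewrite Rabs_minus_sym. apply K; assumption.
  - apply K; assumption. }
destruct (G Re re_le_Cmod) as [a Ha]; [reflexivity|].
destruct (G Im im_le_Cmod) as [b Hb]; [reflexivity|].
exists (a, b). split; assumption.
Qed.

(** The relative increments telescope. Multiplying the factors [1 + K (1/j - 1/(j+1))], each below
    an exponential, bounds [u]; summing the increments then gives [|u m - u n| <= K M / n], a Cauchy
    estimate. *)
Lemma ex_Clim_ratio (u : nat -> C) (K : R) N : (1 <= N)%nat -> (0 <= K)%R ->
  (forall n, (N <= n)%nat ->
     (Cmod (u (S n) - u n) <= K * (/ INR n - / INR (S n)) * Cmod (u n))%R) ->
  exists l, is_Clim u l.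
Proof.
intros HN HK H.
assert (P : forall n, (N <= n)%nat -> (0 < / INR (S n) <= / INR n)%R).
{ intros n Hn. assert (0 < INR n)%R by (apply lt_0_INR; lia).
  split; [apply Rinv_0_lt_compat, lt_0_INR; lia|].
  apply Rinv_le_contravar; [assumption|apply le_INR; lia]. }
assert (B : forall n, (Cmod (u (N + n)%nat) <= Cmod (u N) * exp (K * (/ INR N - / INR (N + n))))%R).
{ induction n.
  - rewrite Nat.add_0_r, Rminus_diag, Rmult_0_r, exp_0. lra.
  - rewrite Nat.add_succ_r.
    set (m := (N + n)%nat) in *.
    replace (K * (/ INR N - / INR (S m)))%R
      with (K * (/ INR N - / INR m) + K * (/ INR m - / INR (S m)))%R by ring.
    rewrite exp_plus, <- Rmult_assoc.
    assert (T : (Cmod (u (S m)) <= (1 + K * (/ INR m - / INR (S m))) * Cmod (u m))%R).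
    { replace (u (S m)) with (u m + (u (S m) - u m)) by ring.
      eapply Rle_trans; [apply Cmod_triangle|].
      generalize (H m ltac:(unfold m; lia)). lra. }
    eapply Rle_trans; [exact T|]. rewrite Rmult_comm.
    apply Rmult_le_compat; try apply Cmod_ge_0; try assumption.
    + generalize (P m ltac:(unfold m; lia)). intros. nra.
    + apply exp_ineq1_le. }
set (M := (Cmod (u N) * exp (K * / INR N))%R).
assert (B' : forall n, (N <= n)%nat -> (Cmod (u n) <= M)%R).
{ intros n Hn. replace n with (N + (n - N))%nat by lia.
  eapply Rle_trans; [apply B|]. apply Rmult_le_compat_l; [apply Cmod_ge_0|].
  apply exp_le_exp, Rmult_le_compat_l; [assumption|].
  assert (0 < / INR (N + (n - N)))%R by (apply Rinv_0_lt_compat, lt_0_INR; lia). lra. }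
apply ex_Clim_cauchy with (K * M)%R N.
intros n m Hn Hm. replace m with (n + (m - n))%nat by lia.
assert (D : forall j, (Cmod (u (n + j)%nat - u n) <= K * M * (/ INR n - / INR (n + j)))%R).
{ induction j.
  - rewrite Nat.add_0_r. replace (u n - u n) with (RtoC 0) by ring. rewrite Cmod_0. lra.
  - rewrite Nat.add_succ_r. set (q := (n + j)%nat) in *.
    replace (u (S q) - u n) with ((u (S q) - u q) + (u q - u n)) by ring.
    eapply Rle_trans; [apply Cmod_triangle|].
    assert (Cmod (u (S q) - u q) <= K * (/ INR q - / INR (S q)) * M)%R.
    { eapply Rle_trans; [apply H; unfold q; lia|].
      apply Rmult_le_compat_l; [|apply B'; unfold q; lia].
      generalize (P q ltac:(unfold q; lia)). nra. }
    lra. }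
eapply Rle_trans; [apply D|]. unfold Rdiv.
assert (0 <= M)%R by (eapply Rle_trans; [apply Cmod_ge_0|apply (B' N); lia]).
assert (0 < / INR (n + (m - n)))%R by (apply Rinv_0_lt_compat, lt_0_INR; lia).
apply Rmult_le_compat_l; [nra|lra].
Qed.

(* Applied both to [u] and to [1 / u], the summable bound on the ratios gives
   limits whose product is [1]. *)
Lemma ex_Clim_ratio_neq_0 (u : nat -> C) (K : R) N : (1 <= N)%nat -> (0 <= K)%R ->
  (forall n, (N <= n)%nat -> u n <> 0) ->
  (forall n, (N <= n)%nat ->
     (Cmod (u (S n) / u n - 1) <= K * (/ INR n - / INR (S n)))%R) ->
  exists l, is_Clim u l /\ l <> 0.
Proof.
intros HN HK Hu H.
assert (R1 : forall n, (N <= n)%nat -> (Cmod (u n) > 0)%R)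
  by (intros n Hn; apply Cmod_gt_0, Hu, Hn).
assert (D : forall n, (N <= n)%nat ->
  Cmod (u (S n) - u n) = (Cmod (u (S n) / u n - 1) * Cmod (u n))%R).
{ intros n Hn. rewrite <- Cmod_mult. f_equal. field. auto. }
destruct (ex_Clim_ratio u K N HN HK) as [l Hl].
{ intros n Hn. rewrite (D n Hn). apply Rmult_le_compat_r; [apply Cmod_ge_0|auto]. }
(* Once the relative increment is at most [1/2], [|u n| <= 2 |u (S n)|], so [1 / u] satisfies the
   same kind of bound with [2 K]. *)
assert (E : exists N', (N <= N')%nat /\ forall n, (N' <= n)%nat -> (K * (/ INR n - / INR (S n)) <= 1/2)%R).
{ generalize (is_lim_seq_div_INR K). intros L. apply is_lim_seq_spec in L.
  destruct (L (mkposreal (1/2) ltac:(lra))) as [N1 L1]. simpl in L1.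
  exists (max N N1). split; [lia|]. intros n Hn. generalize (L1 n ltac:(lia)).
  rewrite Rminus_0_r. intros HH. apply Rabs_lt_between in HH.
  assert (0 < / INR (S n))%R by (apply Rinv_0_lt_compat, lt_0_INR; lia).
  unfold Rdiv in HH. nra. }
destruct E as [N' [HN' E]].
destruct (ex_Clim_ratio (fun n => / u n) (2 * K)%R N' ltac:(lia) ltac:(lra)) as [l' Hl'].
{ intros n Hn.
  assert (a0 := Hu n ltac:(lia)). assert (a1 := Hu (S n) ltac:(lia)).
  assert (r1 := R1 n ltac:(lia)). assert (r2 := R1 (S n) ltac:(lia)).
  replace (/ u (S n) - / u n) with ((u n - u (S n)) / u (S n) * / u n) by (field; auto).
  rewrite Cmod_mult. apply Rmult_le_compat_r; [apply Cmod_ge_0|].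
  rewrite Cmod_div by auto. rewrite Cmod_minus_sym, (D n) by lia.
  assert (h := H n ltac:(lia)). assert (e := E n Hn).
  set (q := Cmod (u (S n) / u n - 1)) in *.
  assert (Cmod (u n) <= 2 * Cmod (u (S n)))%R.
  { assert (Dn := D n ltac:(lia)). fold q in Dn.
    generalize (Cmod_triangle (u (S n)) (u n - u (S n))). rewrite (Cmod_minus_sym (u n)).
    replace (u (S n) + (u n - u (S n))) with (u n) by ring. rewrite Dn. nra. }
  apply Rle_div_l; [assumption|].
  assert (0 <= q)%R by apply Cmod_ge_0. nra. }
exists l. split; [exact Hl|]. intros ->.
apply C1_nz. apply is_Clim_unique with (fun n => u n * / u n).
- apply is_Clim_ext_from with N (fun _ => 1); [|apply is_Clim_const].
  intros n Hn. field. auto.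
- replace (RtoC 0) with (0 * l') by ring. apply is_Clim_mult; assumption.
Qed.

(** * The complex exponential *)

Lemma Cexp_plus (a b : C) : Cexp (a + b) = Cexp a * Cexp b.
Proof.
destruct a, b. apply C_eq; simpl; rewrite exp_plus; [rewrite cos_plus|rewrite sin_plus]; ring.
Qed.

Lemma Cexp_0 : Cexp 0 = 1.
Proof. apply C_eq; simpl; rewrite exp_0, ?cos_0, ?sin_0; ring. Qed.

Lemma Cexp_neq_0 (z : C) : Cexp z <> 0.
Proof.
intros E. apply C1_nz. rewrite <- Cexp_0.
replace (RtoC 0) with (z + - z) by ring. rewrite Cexp_plus, E. ring.
Qed.

Lemma Cexp_opp (z : C) : Cexp (- z) = / Cexp z.
Proof.
replace (Cexp (- z)) with (Cexp z * Cexp (- z) / Cexp z) by (field; apply Cexp_neq_0).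
rewrite <- Cexp_plus, Cplus_opp_r, Cexp_0. field. apply Cexp_neq_0.
Qed.

Lemma Cexp_RtoC (r : R) : Cexp r = exp r.
Proof. apply C_eq; simpl; rewrite ?cos_0, ?sin_0; ring. Qed.

(** The upper bounds come from [exp (- a) >= 1 - a], which gives [exp a (1 - a) <= 1]. *)
Lemma exp_second_order (a : R) : (Rabs a <= 1/2)%R ->
  (0 <= exp a - 1 - a <= 2 * a ^ 2)%R /\ (exp a <= 2)%R /\ (Rabs (exp a - 1) <= 2 * Rabs a)%R.
Proof.
intros H. apply Rabs_le_between in H.
generalize (exp_ineq1_le a) (exp_ineq1_le (- a)) (exp_pos a). intros H1 H2 H3.
assert (H4 : (exp a * exp (- a) = 1)%R) by (rewrite <- exp_plus, Rplus_opp_r; apply exp_0).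
assert (H5 : (exp a * (1 - a) <= 1)%R) by nra.
assert (H6 : (exp a <= 2)%R) by nra.
assert (H7 : (exp a - 1 - a <= 2 * a ^ 2)%R) by nra.
repeat split; try lra.
unfold Rabs; repeat destruct Rcase_abs; nra.
Qed.

(** Uses [1 - cos b = 2 sin^2 (b/2)] and [|sin u| <= |u|]; the latter is trivial for [|u| > 1], and
    smaller arguments lie where the sign of the sine is known. *)
Lemma cos_second_order (b : R) : (0 <= 1 - cos b <= b ^ 2 / 2)%R.
Proof.
split; [generalize (COS_bound b); lra|].
replace b with (2 * (b / 2))%R at 1 by field.
rewrite cos_2a_sin.
assert (H : (Rabs (sin (b/2)) <= Rabs (b / 2))%R).
{ unfold Rabs at 2. destruct (Rcase_abs (b/2)) as [h|h].
  - rewrite <- Rabs_Ropp, <- sin_neg.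
    destruct (Rle_lt_dec (- (b / 2)) 1) as [i|i].
    + rewrite Rabs_pos_eq; [left; apply sin_lt_x; lra|].
      apply sin_ge_0; [lra|generalize PI2_1; lra].
    + generalize (SIN_bound (- (b/2))). intros. apply Rabs_le. lra.
  - destruct (Rle_lt_dec (b / 2) 1) as [i|i].
    + rewrite Rabs_pos_eq.
      * destruct h as [h|h]; [left; apply sin_lt_x; lra|rewrite h, sin_0; lra].
      * apply sin_ge_0; [lra|generalize PI2_1; lra].
    + generalize (SIN_bound (b/2)). intros. apply Rabs_le. lra. }
apply Rsqr_le_abs_1 in H. unfold Rsqr in H. nra.
Qed.

(** By the mean value theorem, [sin b - b = (cos c - 1) b] with [|c| <= |b|]. *)
Lemma sin_second_order (b : R) : (Rabs b <= 1/2)%R -> (Rabs (sin b - b) <= b ^ 2)%R.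
Proof.
intros H.
destruct (MVT_gen (fun t => sin t - t)%R 0 b (fun t => cos t - 1)%R) as [c [Hc E]].
- intros x _. auto_derive; [exact I|ring].
- intros x _. apply continuity_pt_filterlim, (continuous_minus (V:=R_NormedModule)).
  + apply continuity_pt_filterlim, continuity_sin.
  + apply continuous_id.
- rewrite sin_0 in E.
  replace (sin b - b)%R with ((cos c - 1) * (b - 0))%R by (rewrite <- E; ring).
  rewrite Rabs_mult, Rminus_0_r.
  generalize (cos_second_order c). intros [H1 H2].
  rewrite (Rabs_left1 (cos c - 1)) by lra.
  assert (Rabs c <= Rabs b)%R.
  { revert Hc. unfold Rmin, Rmax, Rabs. destruct Rle_dec; repeat destruct Rcase_abs; lra. }
  assert (c ^ 2 <= Rabs b ^ 2)%R.
  { rewrite <- (pow2_abs c). apply pow_incr. split; [apply Rabs_pos|assumption]. }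
  rewrite <- (pow2_abs b). generalize (Rabs_pos b). nra.
Qed.

(** This quadratic remainder is what makes consecutive Gauss terms have ratio [1 + O(1/n^2)]. The
    constant [8] is generous: the two components add up to at most [3 a^2 + 4 b^2]. *)
Lemma Cexp_second_order (w : C) : (Cmod w <= 1/2)%R ->
  (Cmod (Cexp w - 1 - w) <= 8 * Cmod w ^ 2)%R.
Proof.
intros H. destruct w as [a b].
assert (Ha := re_le_Cmod (a, b)). assert (Hb := im_le_Cmod (a, b)). simpl in Ha, Hb.
destruct (exp_second_order a ltac:(lra)) as [E1 [E2 E3]].
assert (C1 := cos_second_order b). assert (S1 := sin_second_order b ltac:(lra)).
rewrite Cmod2_alt; simpl Re; simpl Im.
eapply Rle_trans; [apply Cmod_le_abs|]. unfold Cminus, Cplus, Copp, Cexp, Re, Im; cbn [fst snd RtoC].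
replace (exp a * cos b + - (1) + - a)%R with ((exp a - 1 - a) + exp a * (cos b - 1))%R by ring.
replace (exp a * sin b + - 0 + - b)%R with (exp a * (sin b - b) + b * (exp a - 1))%R by ring.
assert (Rabs ((exp a - 1 - a) + exp a * (cos b - 1)) <= 2 * a ^ 2 + b ^ 2)%R.
{ assert (0 < exp a)%R by apply exp_pos. apply Rabs_le. nra. }
assert (Rabs (exp a * (sin b - b) + b * (exp a - 1)) <= 2 * b ^ 2 + 2 * (Rabs a * Rabs b))%R.
{ eapply Rle_trans; [apply Rabs_triang|]. rewrite !Rabs_mult.
  rewrite (Rabs_pos_eq (exp a)) by (left; apply exp_pos).
  assert (0 < exp a)%R by apply exp_pos.
  assert (exp a * Rabs (sin b - b) <= 2 * b ^ 2)%R
    by (apply Rmult_le_compat; [lra|apply Rabs_pos|lra|lra]).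
  assert (Rabs b * Rabs (exp a - 1) <= Rabs b * (2 * Rabs a))%R
    by (apply Rmult_le_compat_l; [apply Rabs_pos|lra]).
  lra. }
assert (2 * (Rabs a * Rabs b) <= a ^ 2 + b ^ 2)%R.
{ rewrite <- (pow2_abs a), <- (pow2_abs b). generalize (pow2_ge_0 (Rabs a - Rabs b)). lra. }
generalize (pow2_ge_0 a) (pow2_ge_0 b). lra.
Qed.

Lemma is_Clim_Cexp u l : is_Clim u l -> is_Clim (fun n => Cexp (u n)) (Cexp l).
Proof.
intros [H1 H2].
assert (E : is_lim_seq (fun n => exp (Re (u n))) (exp (Re l)))
  by (apply is_lim_seq_continuous; [apply derivable_continuous_pt, derivable_pt_exp|exact H1]).
split; apply is_lim_seq_mult'; try exact E;
  apply is_lim_seq_continuous; try exact H2; [apply continuity_cos|apply continuity_sin].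
Qed.

Lemma Cpower_plus c (a b : C) : Cpower c (a + b) = Cpower c a * Cpower c b.
Proof. unfold Cpower. rewrite Cmult_plus_distr_r. apply Cexp_plus. Qed.

Lemma Cpower_0 c : Cpower c 0 = 1.
Proof. unfold Cpower. rewrite Cmult_0_l. apply Cexp_0. Qed.

Lemma Cpower_opp c (z : C) : Cpower c (- z) = / Cpower c z.
Proof. unfold Cpower. rewrite <- Cexp_opp. f_equal. ring. Qed.

Lemma Cpower_minus c (a b : C) : Cpower c (a - b) = Cpower c a / Cpower c b.
Proof. unfold Cminus. rewrite Cpower_plus, Cpower_opp. reflexivity. Qed.

Lemma Cpower_neq_0 c (z : C) : Cpower c z <> 0.
Proof. apply Cexp_neq_0. Qed.

Lemma Cpower_mult_base (c d : R) (z : C) : (0 < c)%R -> (0 < d)%R ->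
  Cpower (c * d) z = Cpower c z * Cpower d z.
Proof.
intros. unfold Cpower. rewrite ln_mult, RtoC_plus by assumption.
rewrite Cmult_plus_distr_l. apply Cexp_plus.
Qed.

Lemma Cpower_div_base (c d : R) (z : C) : (0 < c)%R -> (0 < d)%R ->
  Cpower (c / d) z = Cpower c z / Cpower d z.
Proof.
intros. replace c with ((c / d) * d)%R at 2 by (field; lra).
rewrite Cpower_mult_base by (try apply Rdiv_lt_0_compat; assumption).
field. apply Cpower_neq_0.
Qed.

Lemma Cpower_RtoC (c s : R) : Cpower c s = Rpower c s.
Proof. unfold Cpower. rewrite <- RtoC_mult. apply Cexp_RtoC. Qed.

Lemma Cpower_INR (c : R) (n : nat) : (0 < c)%R -> Cpower c (INR n) = (c ^ n)%R.
Proof. intros. rewrite Cpower_RtoC, Rpower_pow; auto. Qed.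

Lemma Cpower_1 (c : R) : (0 < c)%R -> Cpower c 1 = c.
Proof. intros. rewrite Cpower_RtoC, Rpower_1; auto. Qed.

(** * Finite products *)

Lemma Cprod_ext (f g : nat -> C) n : (forall i, (i < n)%nat -> f i = g i) -> Cprod f n = Cprod g n.
Proof.
induction n; simpl; intros H; [reflexivity|].
rewrite H, IHn by auto. reflexivity.
Qed.

Lemma Cprod_mult (f g : nat -> C) n : Cprod (fun i => f i * g i) n = Cprod f n * Cprod g n.
Proof. induction n; simpl; [ring|]. rewrite IHn. ring. Qed.

Lemma Cprod_const (c : C) n : Cprod (fun _ => c) n = c ^ n.
Proof. induction n; simpl; [reflexivity|]. rewrite IHn. ring. Qed.

Lemma Cprod_scal (c : C) (f : nat -> C) n : Cprod (fun i => c * f i) n = c ^ n * Cprod f n.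
Proof. rewrite Cprod_mult, Cprod_const. reflexivity. Qed.

Lemma Cprod_S_l (f : nat -> C) n : Cprod f (S n) = f O * Cprod (fun i => f (S i)) n.
Proof. induction n; simpl; [ring|]. simpl in IHn. rewrite IHn. ring. Qed.

Lemma Cprod_add (f : nat -> C) n m : Cprod f (n + m) = Cprod f n * Cprod (fun i => f (n + i)%nat) m.
Proof.
induction m; simpl; [rewrite Nat.add_0_r; ring|].
rewrite Nat.add_succ_r; simpl. rewrite IHm. ring.
Qed.

Lemma Cprod_rev (f : nat -> C) n : Cprod f n = Cprod (fun i => f (n - 1 - i)%nat) n.
Proof.
induction n; [reflexivity|]. rewrite (Cprod_S_l (fun i => f (S n - 1 - i)%nat)).
replace (S n - 1 - 0)%nat with n by lia.
rewrite (Cprod_ext (fun i => f (S n - 1 - S i)%nat) (fun i => f (n - 1 - i)%nat))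
  by (intros; f_equal; lia).
rewrite <- IHn. simpl. ring.
Qed.

Lemma Cprod_exchange (f : nat -> nat -> C) n m :
  Cprod (fun i => Cprod (f i) m) n = Cprod (fun j => Cprod (fun i => f i j) n) m.
Proof.
induction n; simpl.
- rewrite Cprod_const, Cpow_1_l. reflexivity.
- rewrite IHn, <- Cprod_mult. reflexivity.
Qed.

Lemma Cinv_neq_0 (z : C) : z <> 0 -> / z <> 0.
Proof.
intros H E. apply C1_nz. rewrite <- (Cinv_r z H), E. ring.
Qed.

Lemma Cprod_neq_0 (f : nat -> C) n : (forall i, (i < n)%nat -> f i <> 0) -> Cprod f n <> 0.
Proof.
induction n; simpl; intros H; [apply C1_nz|].
apply Cmult_neq_0; [apply IHn; auto|apply H; lia].
Qed.

(** * Gauss' limit formula *)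

Definition gauss_seq (z : C) (n : nat) : C :=
  INR (fact n) * Cpower (INR n) z / Cprod (fun i => z + INR i) (S n).

Definition CGamma (z : C) : C := Clim_seq (gauss_seq z).

Definition not_pole (z : C) : Prop := forall j : nat, z <> - INR j.

Lemma not_pole_neq_0 z j : not_pole z -> z + INR j <> 0.
Proof.
intros H E. apply (H j). replace z with (z + INR j - INR j) by ring. rewrite E. ring.
Qed.

Lemma not_pole_shift z : not_pole z -> not_pole (z + 1).
Proof.
intros H j E. apply (H (S j)). rewrite S_INR, RtoC_plus.
replace z with (z + 1 - 1) by ring. rewrite E. ring.
Qed.

Lemma INR_fact_neq_0C n : RtoC (INR (fact n)) <> 0.
Proof. intros E. apply RtoC_inj in E. generalize (INR_fact_neq_0 n). auto. Qed.

Lemma RtoC_neq_0 r : r <> 0%R -> RtoC r <> 0.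
Proof. intros H E. apply RtoC_inj in E. auto. Qed.

Lemma gauss_seq_neq_0 z n : not_pole z -> gauss_seq z n <> 0.
Proof.
intros H. apply Cmult_neq_0; [apply Cmult_neq_0|].
- apply INR_fact_neq_0C.
- apply Cpower_neq_0.
- apply Cinv_neq_0, Cprod_neq_0. intros. apply not_pole_neq_0, H.
Qed.

(** Both sides are [ln x <= x - 1], applied to [(n+1)/n] and to its inverse. *)
Lemma ln_one_plus_inv n : (1 <= n)%nat ->
  (/ INR (S n) <= ln (INR (S n)) - ln (INR n) <= / INR n)%R.
Proof.
intros Hn.
assert (0 < INR n)%R by (apply lt_0_INR; lia).
assert (0 < INR (S n))%R by (apply lt_0_INR; lia).
assert (L : forall a b, (0 < a)%R -> (0 < b)%R -> (ln a - ln b <= a / b - 1)%R).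
{ intros a b Ha Hb. rewrite <- ln_div by assumption.
  generalize (exp_ineq1_le (ln (a/b))). rewrite exp_ln by (apply Rdiv_lt_0_compat; assumption).
  lra. }
split.
- generalize (L (INR n) (INR (S n)) ltac:(assumption) ltac:(assumption)).
  intros h. replace (/ INR (S n))%R with (1 - INR n / INR (S n))%R; [lra|].
  rewrite S_INR in *. field. lra.
- generalize (L (INR (S n)) (INR n) ltac:(assumption) ltac:(assumption)).
  intros h. replace (/ INR n)%R with (INR (S n) / INR n - 1)%R; [lra|].
  rewrite S_INR in *. field. lra.
Qed.

Lemma exists_nat_ge (r : R) : exists N, (1 <= N)%nat /\ (r <= INR N)%R.
Proof.
destruct (nfloor_ex (Rmax r 0)) as [N HN]; [apply Rmax_r|].
exists (S N). split; [lia|]. rewrite S_INR. generalize (Rmax_l r 0). lra.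
Qed.

Lemma gauss_seq_cv z : not_pole z -> exists l, is_Clim (gauss_seq z) l /\ l <> 0.
Proof.
intros Hz.
(* From [n >= 2 |z|] on, [|z h| <= 1/2], as the exponential estimate requires, and
   [|z + n + 1| >= (n + 1) / 2]. *)
destruct (exists_nat_ge (2 * Cmod z)) as [N [HN1 HN]].
assert (Hm := Cmod_ge_0 z).
(* In the numerator of [E] below, the exponential remainder costs at most [16 |z|^2 / n], since
   [n + 1 <= 2 n], and the logarithm [|z| / n]; dividing by [(n + 1) / 2] doubles both constants and
   leaves [1 / (n (n + 1)) = 1/n - 1/(n+1)]. *)
apply ex_Clim_ratio_neq_0 with (32 * Cmod z ^ 2 + 2 * Cmod z)%R N; [assumption|nra| |].
{ intros. apply gauss_seq_neq_0, Hz. }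
intros n Hn.
assert (HnN : (INR N <= INR n)%R) by (apply le_INR, Hn).
assert (P0 : (1 <= INR n)%R) by (apply (le_INR 1); lia).
assert (PS : INR (S n) = (INR n + 1)%R) by apply S_INR.
destruct (ln_one_plus_inv n ltac:(lia)) as [L1 L2].
set (h := (ln (INR (S n)) - ln (INR n))%R) in *.
assert (Nz : z + INR (S n) <> 0) by (apply not_pole_neq_0, Hz).
(* The ratio is [(n + 1) Cexp (z h) / (z + n + 1)]. Adding and subtracting [z (n + 1) h] exposes the
   cancellation of the terms of order [1/n]. *)
assert (E : gauss_seq z (S n) / gauss_seq z n - 1 =
  (INR (S n) * (Cexp (z * h) - 1 - z * h) + z * (INR (S n) * h - 1)%R) / (z + INR (S n))).
{ assert (Hq : Cpower (INR (S n)) z = Cpower (INR n) z * Cexp (z * h)).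
  { unfold Cpower, h. rewrite <- Cexp_plus. f_equal. rewrite RtoC_minus. ring. }
  unfold gauss_seq. rewrite Hq.
  change (Cprod (fun i => z + INR i) (S (S n)))
    with (Cprod (fun i => z + INR i) (S n) * (z + INR (S n))).
  rewrite fact_simpl, mult_INR, RtoC_mult, RtoC_minus, RtoC_mult.
  field. repeat split; first [exact Nz|apply Cpower_neq_0|apply INR_fact_neq_0C
    |apply Cprod_neq_0; intros; apply not_pole_neq_0, Hz]. }
rewrite E, Cmod_div by exact Nz.
assert (Hd : (INR (S n) / 2 <= Cmod (z + INR (S n)))%R).
{ generalize (Cmod_triangle_rev (RtoC (INR (S n))) z). rewrite Cmod_R, Rabs_pos_eq by lra.
  rewrite (Cplus_comm z). lra. }
assert (I0 : (0 < / INR (S n))%R) by (apply Rinv_0_lt_compat; lra).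
assert (I1 : (0 < / INR n)%R) by (apply Rinv_0_lt_compat; lra).
assert (J0 : (INR (S n) * / INR (S n) = 1)%R) by (apply Rinv_r; lra).
assert (J1 : (INR n * / INR n = 1)%R) by (apply Rinv_r; lra).
assert (Hzh : (Cmod (z * h) <= Cmod z * / INR n)%R).
{ rewrite Cmod_mult, Cmod_R, Rabs_pos_eq by lra. nra. }
assert (Hsmall : (Cmod (z * h) <= 1/2)%R) by nra.
assert (T := Cexp_second_order _ Hsmall).
assert (T' : (Cmod (z * h) ^ 2 <= Cmod z ^ 2 * / INR n ^ 2)%R).
{ rewrite <- pow_inv, <- Rpow_mult_distr. apply pow_incr. split; [apply Cmod_ge_0|exact Hzh]. }
assert (D : (/ INR n - / INR (S n) = / INR n * / INR (S n))%R) by (rewrite PS; field; lra).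
rewrite D.
apply Rle_div_l; [lra|].
apply Rle_trans with ((32 * Cmod z ^ 2 + 2 * Cmod z) * (/ INR n * / INR (S n)) * (INR (S n) / 2))%R.
2:{ apply Rmult_le_compat_l; [|exact Hd]. apply Rmult_le_pos; nra. }
replace ((32 * Cmod z ^ 2 + 2 * Cmod z) * (/ INR n * / INR (S n)) * (INR (S n) / 2))%R
  with (16 * Cmod z ^ 2 * / INR n + Cmod z * / INR n)%R by (field; lra).
eapply Rle_trans; [apply Cmod_triangle|]. rewrite !Cmod_mult, !Cmod_R.
apply Rplus_le_compat.
- rewrite Rabs_pos_eq by lra.
  apply Rle_trans with (INR (S n) * (8 * (Cmod z ^ 2 * / INR n ^ 2)))%R.
  + apply Rmult_le_compat_l; lra.
  + replace (16 * Cmod z ^ 2 * / INR n)%R with ((2 * INR n) * (8 * (Cmod z ^ 2 * / INR n ^ 2)))%R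
      by (field; lra).
    apply Rmult_le_compat_r; [|lra].
    assert (0 < / INR n ^ 2)%R by (apply Rinv_0_lt_compat, pow_lt; lra). nra.
- apply Rmult_le_compat_l; [assumption|]. apply Rabs_le. nra.
Qed.

Lemma is_Clim_gauss_seq z : not_pole z -> is_Clim (gauss_seq z) (CGamma z).
Proof.
intros H. destruct (gauss_seq_cv z H) as [l [Hl _]].
unfold CGamma. rewrite (Clim_seq_unique _ _ Hl). exact Hl.
Qed.

Lemma CGamma_neq_0 z : not_pole z -> CGamma z <> 0.
Proof.
intros H. destruct (gauss_seq_cv z H) as [l [Hl Nl]].
unfold CGamma. rewrite (Clim_seq_unique _ _ Hl). exact Nl.
Qed.

Lemma is_Clim_INR_ratio (c : C) : is_Clim (fun n => INR n / (INR n + c)) 1.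
Proof.
assert (L : is_Clim (fun n => / (1 + c * (1 / INR n)%R)) (/ (1 + c * 0))).
{ apply is_Clim_inv; [|replace (1 + c * 0) with (RtoC 1) by ring; apply C1_nz].
  apply is_Clim_plus; [apply is_Clim_const|].
  apply is_Clim_mult; [apply is_Clim_const|apply is_Clim_RtoC, is_lim_seq_div_INR]. }
replace (/ (1 + c * 0)) with (RtoC 1) in L by (rewrite Cmult_0_r, Cplus_0_r; field; apply C1_nz).
destruct (exists_nat_ge (2 * Cmod c + 1)) as [N [HN1 HN]].
eapply is_Clim_ext_from with (N := N); [|exact L].
intros n Hn.
assert (HnN : (INR N <= INR n)%R) by (apply le_INR, Hn).
assert (Hc := Cmod_ge_0 c).
assert (RtoC (INR n) <> 0) by (apply RtoC_neq_0; lra).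
cbv beta. rewrite RtoC_div by lra.
assert (INR n + c <> 0).
{ apply Cmod_gt_0. generalize (Cmod_triangle_rev (INR n) c).
  rewrite Cmod_R, Rabs_pos_eq by lra. lra. }
field. auto.
Qed.

(** At finite [n] the equation holds up to the factor [n / (n + z + 1)]: the two products share all
    factors except the first of one and the last of the other. *)
Lemma CGamma_shift z : not_pole z -> CGamma (z + 1) = z * CGamma z.
Proof.
intros H. assert (H' := not_pole_shift z H).
apply is_Clim_unique with (gauss_seq (z + 1)); [apply is_Clim_gauss_seq, H'|].
replace (z * CGamma z) with (z * (CGamma z * 1)) by ring.
eapply is_Clim_ext_from with (N := 1%nat);
  [|apply is_Clim_mult; [apply is_Clim_const|apply is_Clim_mult;
     [apply is_Clim_gauss_seq, H|apply (is_Clim_INR_ratio (z + 1))]]].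
intros n Hn; cbv beta. unfold gauss_seq.
rewrite Cpower_plus, Cpower_1 by (apply lt_0_INR; lia).
assert (E : z * Cprod (fun i => z + 1 + INR i) (S n)
   = Cprod (fun i => z + INR i) (S n) * (INR n + (z + 1))).
{ transitivity (Cprod (fun i => z + INR i) (S (S n))).
  - rewrite (Cprod_S_l (fun i => z + INR i)); cbv beta.
    change (INR 0) with 0%R. rewrite Cplus_0_r. f_equal. apply Cprod_ext. intros.
    rewrite S_INR, RtoC_plus. ring.
  - change (Cprod (fun i => z + INR i) (S (S n)))
      with (Cprod (fun i => z + INR i) (S n) * (z + INR (S n))).
    rewrite S_INR, RtoC_plus. f_equal. ring. }
assert (z <> 0) by (intros ->; apply (H 0%nat); simpl; ring).
assert (P1 : Cprod (fun i => z + 1 + INR i) (S n) <> 0)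
  by (apply Cprod_neq_0; intros; apply not_pole_neq_0, H').
assert (P2 : Cprod (fun i => z + INR i) (S n) <> 0)
  by (apply Cprod_neq_0; intros; apply not_pole_neq_0, H).
assert (P3 : INR n + (z + 1) <> 0)
  by (rewrite Cplus_comm; apply not_pole_neq_0, H').
replace (Cprod (fun i => z + 1 + INR i) (S n))
  with (Cprod (fun i => z + INR i) (S n) * (INR n + (z + 1)) / z) by (rewrite <- E; field; auto).
field. auto.
Qed.

Lemma CGamma_shift_INR z n : not_pole z ->
  CGamma (z + INR n) = Cprod (fun i => z + INR i) n * CGamma z.
Proof.
intros H. induction n.
- simpl. rewrite Cplus_0_r. ring.
- rewrite S_INR, RtoC_plus, Cplus_assoc, CGamma_shift, IHn; [simpl; ring|].
  intros j E. apply (H (n + j)%nat). rewrite plus_INR, RtoC_plus.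
  replace z with (z + INR n - INR n) by ring. rewrite E. ring.
Qed.

Lemma not_pole_Re_pos z : (0 < Re z)%R -> not_pole z.
Proof.
intros H j ->. simpl in H. generalize (pos_INR j). lra.
Qed.

Lemma CGamma_1 : CGamma 1 = 1.
Proof.
apply Clim_seq_unique.
eapply is_Clim_ext_from with (N := 1%nat); [|apply (is_Clim_INR_ratio 1)].
intros n Hn; cbv beta. unfold gauss_seq.
rewrite Cpower_1 by (apply lt_0_INR; lia).
assert (E : forall m, Cprod (fun i => 1 + INR i) m = INR (fact m)).
{ induction m; simpl; [reflexivity|].
  rewrite IHm. rewrite plus_INR, mult_INR, RtoC_plus, RtoC_mult. ring. }
rewrite E, fact_simpl, mult_INR, S_INR, RtoC_mult, RtoC_plus.
field. split; [apply INR_fact_neq_0C|].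
rewrite <- RtoC_plus. apply RtoC_neq_0. generalize (pos_INR n). lra.
Qed.

(** * The sine product *)

(* [RInt_ext] states equalities in a canonical structure that [ring] does not see through. *)
Ltac eq_in_R := match goal with |- ?a = ?b => change (@eq R a b) end.

Section CosineMoments.

Local Open Scope R_scope.

(* The real and imaginary parts of [exp (2 i z t) (cos t)^n] for [z = a + i b],
   integrated over [-PI/2, PI/2]. *)
Definition cos_moment_re (a b : R) (n : nat) : R :=
  RInt (fun t => exp (- 2 * b * t) * cos (2 * a * t) * cos t ^ n) (- (PI / 2)) (PI / 2).

Definition cos_moment_im (a b : R) (n : nat) : R :=
  RInt (fun t => exp (- 2 * b * t) * sin (2 * a * t) * cos t ^ n) (- (PI / 2)) (PI / 2).

(** The moment at [z = 0], which normalises the others; its value at [n = 0] supplies the [PI] of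
    the reflection formula. *)
Definition wallis (n : nat) : R := RInt (fun t => cos t ^ n) (- (PI / 2)) (PI / 2).

Lemma ex_RInt_derivable (f : R -> R) a b : (forall t, ex_derive f t) -> ex_RInt f a b.
Proof. intros H. apply (ex_RInt_continuous (V:=R_CompleteNormedModule)). intros; apply (ex_derive_continuous f), H. Qed.

Lemma RInt_of_derive (f df : R -> R) a b l :
  (forall t, is_derive f t (df t)) -> (forall t, ex_derive df t) ->
  f b - f a = l -> RInt df a b = l.
Proof.
intros H H' <-. apply is_RInt_unique.
apply (is_RInt_derive (V:=R_CompleteNormedModule) f df); intros; [apply H|].
apply (ex_derive_continuous df), H'.
Qed.

(** Three terms are what the moment recurrences need; shorter combinations are padded with a
    coefficient [0]. *)
Lemma RInt_lincomb3 (f g h : R -> R) a b c1 c2 c3 :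
  ex_RInt f a b -> ex_RInt g a b -> ex_RInt h a b ->
  RInt (fun t => c1 * f t + c2 * g t + c3 * h t) a b
  = c1 * RInt f a b + c2 * RInt g a b + c3 * RInt h a b.
Proof.
intros Hf Hg Hh. apply is_RInt_unique.
apply (is_RInt_plus (V:=R_NormedModule)); [apply (is_RInt_plus (V:=R_NormedModule))|];
  apply (is_RInt_scal (V:=R_NormedModule)); apply (RInt_correct (V:=R_CompleteNormedModule)); assumption.
Qed.

(* Both recurrences come from differentiating
   [exp (2 i z t) (n (cos t)^(n-1) sin t + 2 i z (cos t)^n)], which vanishes at both ends. *)
Lemma cos_moment_rec_re (a b : R) (n : nat) :
  INR (n + 2) * INR (n + 1) * cos_moment_re a b n
  = (INR (n + 2) ^ 2 - 4 * (a ^ 2 - b ^ 2)) * cos_moment_re a b (n + 2)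
    + 8 * a * b * cos_moment_im a b (n + 2).
Proof.
unfold cos_moment_re, cos_moment_im.
(* The recurrence becomes the vanishing of a single integral, whose integrand is an exact
   derivative. *)
match goal with |- ?x * RInt ?f ?u ?v = ?y * RInt ?g _ _ + ?z * RInt ?h _ _ =>
  assert (E : RInt (fun t => - x * f t + y * g t + z * h t) u v = 0);
  [|rewrite RInt_lincomb3 in E; [lra| | |]; apply ex_RInt_derivable; intros; auto_derive; auto] end.
set (N := INR (n + 2)).
(* The real part of the function differentiated, with exponent [n + 2] in place of [n]; the next
   lemma uses the imaginary part. *)
apply RInt_of_derive with (fun t =>
  exp (- 2 * b * t) * (cos (2 * a * t) * (N * cos t ^ (n + 1) * sin t - 2 * b * cos t ^ (n + 2))
    - sin (2 * a * t) * (2 * a * cos t ^ (n + 2)))).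
- intros t. auto_derive; [exact I|].
  replace (Init.Nat.pred (n + 1)) with n by lia.
  replace (Init.Nat.pred (n + 2)) with (n + 1)%nat by lia.
  fold N. replace (INR (n + 1)) with (N - 1) by (unfold N; rewrite !plus_INR; simpl; ring).
  rewrite !pow_add. simpl (cos t ^ 1). simpl (cos t ^ 2).
  generalize (sin2_cos2 t). unfold Rsqr. intros S2.
  assert (S2' : sin t * sin t = 1 - cos t * cos t) by lra.
  ring_simplify. replace (sin t ^ 2) with (1 - cos t * cos t) by (rewrite <- S2'; ring). ring.
- intros; auto_derive; auto.
- rewrite cos_neg, cos_PI2, !pow_i by lia. ring.
Qed.

Lemma cos_moment_rec_im (a b : R) (n : nat) :
  INR (n + 2) * INR (n + 1) * cos_moment_im a b n
  = (INR (n + 2) ^ 2 - 4 * (a ^ 2 - b ^ 2)) * cos_moment_im a b (n + 2)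
    + - (8 * a * b) * cos_moment_re a b (n + 2).
Proof.
unfold cos_moment_re, cos_moment_im.
match goal with |- ?x * RInt ?f ?u ?v = ?y * RInt ?g _ _ + ?z * RInt ?h _ _ =>
  assert (E : RInt (fun t => - x * f t + y * g t + z * h t) u v = 0);
  [|rewrite RInt_lincomb3 in E; [lra| | |]; apply ex_RInt_derivable; intros; auto_derive; auto] end.
set (N := INR (n + 2)).
apply RInt_of_derive with (fun t =>
  exp (- 2 * b * t) * (sin (2 * a * t) * (N * cos t ^ (n + 1) * sin t - 2 * b * cos t ^ (n + 2))
    + cos (2 * a * t) * (2 * a * cos t ^ (n + 2)))).
- intros t. auto_derive; [exact I|].
  replace (Init.Nat.pred (n + 1)) with n by lia.
  replace (Init.Nat.pred (n + 2)) with (n + 1)%nat by lia.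
  fold N. replace (INR (n + 1)) with (N - 1) by (unfold N; rewrite !plus_INR; simpl; ring).
  rewrite !pow_add. simpl (cos t ^ 1). simpl (cos t ^ 2).
  generalize (sin2_cos2 t). unfold Rsqr. intros S2.
  assert (S2' : sin t * sin t = 1 - cos t * cos t) by lra.
  ring_simplify. replace (sin t ^ 2) with (1 - cos t * cos t) by (rewrite <- S2'; ring). ring.
- intros; auto_derive; auto.
- rewrite cos_neg, cos_PI2, !pow_i by lia. ring.
Qed.

Lemma wallis_moment n : wallis n = cos_moment_re 0 0 n.
Proof.
unfold wallis, cos_moment_re. apply RInt_ext. intros t _.
replace (- 2 * 0 * t) with 0 by ring. replace (2 * 0 * t) with 0 by ring.
rewrite exp_0, cos_0. eq_in_R. ring.
Qed.

Lemma wallis_rec n : INR (n + 1) * wallis n = INR (n + 2) * wallis (n + 2).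
Proof.
rewrite !wallis_moment. generalize (cos_moment_rec_re 0 0 n). intros H.
assert (0 < INR (n + 2)) by (apply lt_0_INR; lia).
apply Rmult_eq_reg_l with (INR (n + 2)); lra.
Qed.

Lemma wallis_0 : wallis 0 = PI.
Proof.
unfold wallis. simpl. rewrite RInt_const.
change ((PI / 2 - - (PI / 2)) * 1 = PI). field.
Qed.

Lemma cos_ge_0_PI2 t : - (PI / 2) <= t <= PI / 2 -> 0 <= cos t.
Proof. intros. apply cos_ge_0; lra. Qed.

(** Positivity propagates through the recurrence from [wallis 0 = PI]; even indices are the ones
    reached by steps of two from [0]. *)
Lemma wallis_even_pos m : 0 < wallis (2 * m).
Proof.
induction m.
- rewrite Nat.mul_0_r, wallis_0. apply PI_RGT_0.
- replace (2 * S m)%nat with (2 * m + 2)%nat by lia.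
  generalize (wallis_rec (2 * m)). intros H.
  assert (0 < INR (2 * m + 1)) by (apply lt_0_INR; lia).
  assert (0 < INR (2 * m + 2)) by (apply lt_0_INR; lia).
  nra.
Qed.

(** The degree-seven Taylor lower bound for the sine gives [2 u <= 5 sin u] on [[0, PI/2]], which
    lies in [[0, 2]]; then [25/4 <= 7]. *)
Lemma sq_le_sin_sq t : - (PI / 2) <= t <= PI / 2 -> t ^ 2 <= 7 * sin t ^ 2.
Proof.
assert (P : forall u, 0 <= u <= PI / 2 -> u ^ 2 <= 7 * sin u ^ 2).
{ intros u Hu. assert (PI / 2 <= 2) by (generalize PI_4; lra).
  destruct (SIN u) as [H1 _]; try lra.
  unfold sin_lb, sin_approx, sin_term in H1. simpl in H1.
  assert (2 * u <= 5 * sin u).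
  { eapply Rle_trans; [|apply Rmult_le_compat_l; [lra|exact H1]].
    assert (0 <= u * u <= 4) by nra. set (x := u * u) in *.
    replace (2 * u) with (u * 2) by ring.
    match goal with |- _ <= ?r => replace r with (u * (5 * (1 - x / 6 + x ^ 2 / 120 - x ^ 3 / 5040)))
      by (unfold x; field) end.
    apply Rmult_le_compat_l; nra. }
  nra. }
intros Ht. destruct (Rle_lt_dec 0 t); [apply P; lra|].
replace (t ^ 2) with ((- t) ^ 2) by ring.
replace (sin t ^ 2) with (sin (- t) ^ 2) by (rewrite sin_neg; ring).
apply P; lra.
Qed.

(** With [sin^2 = 1 - cos^2], the recurrence makes the second moment a fraction [1 / (n + 2)] of the
    total mass: the deviation of [t] has order [n^(-1/2)]. *)
Lemma wallis_sin2 n :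
  RInt (fun t => sin t ^ 2 * cos t ^ n) (- (PI / 2)) (PI / 2) = wallis n / INR (n + 2).
Proof.
assert (E : RInt (fun t => sin t ^ 2 * cos t ^ n) (- (PI / 2)) (PI / 2)
  = 1 * wallis n + (-1) * wallis (n + 2) + 0 * wallis n).
{ unfold wallis. rewrite <- RInt_lincomb3 by (apply ex_RInt_derivable; intros; auto_derive; auto).
  apply RInt_ext. intros t _. rewrite pow_add.
  generalize (sin2_cos2 t). unfold Rsqr. intros S2.
  replace (sin t ^ 2) with (1 - cos t * cos t) by (rewrite <- S2; ring). eq_in_R. ring. }
rewrite E.
assert (0 < INR (n + 2)) by (apply lt_0_INR; lia).
assert (W := wallis_rec n). rewrite !plus_INR in *. simpl in *.
apply Rmult_eq_reg_r with (INR n + (1 + 1)); [|lra].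
replace (wallis n / (INR n + (1 + 1)) * (INR n + (1 + 1))) with (wallis n) by (field; lra). lra.
Qed.

(* A weight [1 + O(t)] changes the integral of [(cos t)^n] by a factor [1 + O(n^(-1/2))]:
   use [|t| <= e + t^2 / e] with [e = n^(-1/2)]. *)
Lemma cos_moment_concentration (f : R -> R) c (M : R) n :
  (forall t, ex_derive f t) -> 0 <= M ->
  (forall t, - (PI / 2) <= t <= PI / 2 -> Rabs (f t - c) <= M * Rabs t) ->
  Rabs (RInt (fun t => f t * cos t ^ n) (- (PI / 2)) (PI / 2) - c * wallis n)
    <= 8 * M / sqrt (INR (n + 2)) * wallis n.
Proof.
intros Hf HM H.
assert (Pi := PI_RGT_0).
assert (N0 : 0 < INR (n + 2)) by (apply lt_0_INR; lia).
set (s := sqrt (INR (n + 2))).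
assert (Hs : 0 < s) by (apply sqrt_lt_R0, N0).
assert (Hss : s * s = INR (n + 2)) by (apply sqrt_sqrt; lra).
assert (E : RInt (fun t => f t * cos t ^ n) (- (PI / 2)) (PI / 2) - c * wallis n
  = RInt (fun t => 1 * (f t * cos t ^ n) + (- c) * cos t ^ n + 0 * cos t ^ n) (- (PI / 2)) (PI / 2)).
{ unfold wallis. rewrite RInt_lincomb3 by (apply ex_RInt_derivable; intros; auto_derive; auto).
  ring. }
rewrite E.
(* Here [8 = 1 + 7]: with [e = 1 / s], the term [e] contributes [M / s], and
   [t^2 / e <= 7 s sin^2 t] contributes [7 M s / s^2]. *)
assert (E2 : 8 * M / s * wallis n
  = RInt (fun t => M / s * cos t ^ n + 7 * (M * s) * (sin t ^ 2 * cos t ^ n) + 0 * cos t ^ n) (- (PI / 2)) (PI / 2)).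
{ rewrite RInt_lincomb3 by (apply ex_RInt_derivable; intros; auto_derive; auto).
  rewrite wallis_sin2, <- Hss. fold (wallis n). field. lra. }
rewrite E2.
apply (norm_RInt_le (V:=R_NormedModule)
  (fun t => 1 * (f t * cos t ^ n) + (- c) * cos t ^ n + 0 * cos t ^ n)
  (fun t => M / s * cos t ^ n + 7 * (M * s) * (sin t ^ 2 * cos t ^ n) + 0 * cos t ^ n)
  (- (PI / 2)) (PI / 2)).
- lra.
- intros t Ht.
  assert (C0 : 0 <= cos t ^ n) by (apply pow_le, cos_ge_0_PI2, Ht).
  change (Rabs (1 * (f t * cos t ^ n) + (- c) * cos t ^ n + 0 * cos t ^ n)
    <= M / s * cos t ^ n + 7 * (M * s) * (sin t ^ 2 * cos t ^ n) + 0 * cos t ^ n).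
  replace (1 * (f t * cos t ^ n) + (- c) * cos t ^ n + 0 * cos t ^ n)
    with ((f t - c) * cos t ^ n) by ring.
  rewrite Rabs_mult, (Rabs_pos_eq (cos t ^ n)) by exact C0.
  replace (M / s * cos t ^ n + 7 * (M * s) * (sin t ^ 2 * cos t ^ n) + 0 * cos t ^ n)
    with (M * (/ s + 7 * s * sin t ^ 2) * cos t ^ n) by (field; lra).
  apply Rmult_le_compat_r; [exact C0|].
  eapply Rle_trans; [apply H, Ht|]. apply Rmult_le_compat_l; [exact HM|].
  assert (T := sq_le_sin_sq t Ht).
  apply Rle_trans with (/ s + s * t ^ 2); [|nra].
  rewrite <- (pow2_abs t).
  apply Rmult_le_reg_l with s; [exact Hs|].
  replace (s * (/ s + s * Rabs t ^ 2)) with (1 + (s * Rabs t) ^ 2) by (field; lra).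
  generalize (pow2_ge_0 (s * Rabs t - 1)) (Rabs_pos t). nra.
- apply (RInt_correct (V:=R_CompleteNormedModule)), ex_RInt_derivable; intros; auto_derive; auto.
- apply (RInt_correct (V:=R_CompleteNormedModule)), ex_RInt_derivable; intros; auto_derive; auto.
Qed.

(** Mean value theorem, with [exp (- 2 b c) <= exp (PI |b|)] for [|c| <= PI/2]. It serves both the
    real and the imaginary part of [exp (2 i z t)]. *)
Lemma exp_trig_lipschitz (a b : R) (f df : R -> R) :
  (forall t, is_derive f t (df t)) -> (forall t, ex_derive df t) ->
  (forall t, Rabs (df t) <= exp (- 2 * b * t) * (2 * (Rabs a + Rabs b))) ->
  forall t, - (PI / 2) <= t <= PI / 2 ->
  Rabs (f t - f 0) <= (exp (PI * Rabs b) * (2 * (Rabs a + Rabs b))) * Rabs t.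
Proof.
intros H H' Hb t Ht.
destruct (MVT_gen f 0 t df) as [c [Hc E]].
- intros; apply H.
- intros x _. apply continuity_pt_filterlim, (ex_derive_continuous f). exists (df x). apply H.
- rewrite E, Rabs_mult, Rminus_0_r. apply Rmult_le_compat_r; [apply Rabs_pos|].
  eapply Rle_trans; [apply Hb|]. apply Rmult_le_compat_r.
  { generalize (Rabs_pos a) (Rabs_pos b). lra. }
  apply exp_le_exp.
  assert (Hc2 : - (PI / 2) <= c <= PI / 2).
  { revert Hc. unfold Rmin, Rmax. destruct Rle_dec; lra. }
  assert (Rabs c <= PI / 2) by (apply Rabs_le; lra).
  replace (- 2 * b * c) with (2 * (- b * c)) by ring.
  assert (- b * c <= Rabs b * Rabs c).
  { rewrite <- Rabs_mult. replace (- b * c) with (- (b * c)) by ring.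
    rewrite <- (Rabs_Ropp (b * c)). apply Rle_abs. }
  generalize (Rabs_pos b). nra.
Qed.

End CosineMoments.

Definition cos_moment (z : C) (n : nat) : C :=
  (cos_moment_re (Re z) (Im z) n, cos_moment_im (Re z) (Im z) n).

Lemma cos_moment_rec z n :
  INR (n + 2) * INR (n + 1) * cos_moment z n
  = (INR (n + 2) * INR (n + 2) - 4 * z * z) * cos_moment z (n + 2).
Proof.
destruct z as [a b].
generalize (cos_moment_rec_re a b n) (cos_moment_rec_im a b n).
unfold cos_moment, Re, Im; cbn [fst snd].
set (p := cos_moment_re a b n). set (q := cos_moment_im a b n).
set (p' := cos_moment_re a b (n + 2)). set (q' := cos_moment_im a b (n + 2)).
set (N := INR (n + 2)). set (N' := INR (n + 1)).
intros H1 H2. apply C_eq; simpl; simpl in H1, H2; lra.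
Qed.

(** For [n = 0] the integrand [exp (2 i z t)] is integrated explicitly. The factor [z] on the left
    avoids dividing by [z]; [E1] and [E2] are the two components of the fundamental theorem for
    [exp (2 i z t)]. *)
Lemma cos_moment_0 z : z * cos_moment z 0 = Csin (PI * z).
Proof.
destruct z as [a b].
set (f := fun t => (exp (- 2 * b * t) * cos (2 * a * t) * cos t ^ 0)%R).
set (g := fun t => (exp (- 2 * b * t) * sin (2 * a * t) * cos t ^ 0)%R).
assert (E1 : RInt (fun t => -2 * b * f t + - (2 * a) * g t + 0 * f t)%R (- (PI / 2)) (PI / 2)
  = (exp (- (PI * b)) * cos (PI * a) - exp (PI * b) * cos (PI * a))%R).
{ apply RInt_of_derive with f; unfold f, g; intros.
  - auto_derive; [exact I|]. simpl. ring.
  - auto_derive; auto.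
  - replace (-2 * b * (PI / 2))%R with (- (PI * b))%R by field.
    replace (-2 * b * - (PI / 2))%R with (PI * b)%R by field.
    replace (2 * a * - (PI / 2))%R with (- (PI * a))%R by field.
    replace (2 * a * (PI / 2))%R with (PI * a)%R by field.
    rewrite cos_neg. simpl. ring. }
assert (E2 : RInt (fun t => -2 * b * g t + 2 * a * f t + 0 * f t)%R (- (PI / 2)) (PI / 2)
  = (exp (- (PI * b)) * sin (PI * a) + exp (PI * b) * sin (PI * a))%R).
{ apply RInt_of_derive with g; unfold f, g; intros.
  - auto_derive; [exact I|]. simpl. ring.
  - auto_derive; auto.
  - replace (-2 * b * (PI / 2))%R with (- (PI * b))%R by field.
    replace (-2 * b * - (PI / 2))%R with (PI * b)%R by field.
    replace (2 * a * - (PI / 2))%R with (- (PI * a))%R by field.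
    replace (2 * a * (PI / 2))%R with (PI * a)%R by field.
    rewrite sin_neg. simpl. ring. }
assert (F : forall u v, ex_RInt f u v) by (intros; apply ex_RInt_derivable; unfold f; intros; auto_derive; auto).
assert (G : forall u v, ex_RInt g u v) by (intros; apply ex_RInt_derivable; unfold g; intros; auto_derive; auto).
rewrite RInt_lincomb3 in E1, E2 by auto.
change (RInt f (- (PI / 2)) (PI / 2)) with (cos_moment_re a b 0) in E1, E2.
change (RInt g (- (PI / 2)) (PI / 2)) with (cos_moment_im a b 0) in E1, E2.
unfold cos_moment, Csin; unfold Re, Im; cbn [fst snd].
set (p := cos_moment_re a b 0) in *. set (q := cos_moment_im a b 0) in *.
assert (N : 2 * Ci <> 0) by (apply Cmult_neq_0; [apply RtoC_neq_0; lra|apply Ci_nz]).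
replace ((a, b) * (p, q)) with (2 * Ci * ((a, b) * (p, q)) / (2 * Ci)) by (field; exact Ci_nz).
f_equal. unfold Cexp, Ci, RtoC, Cmult, Cminus, Cplus, Copp, Re, Im; cbn [fst snd].
replace (0 * (PI * a - 0 * b) - 1 * (PI * b + 0 * a))%R with (- (PI * b))%R by ring.
replace (0 * (PI * b + 0 * a) + 1 * (PI * a - 0 * b))%R with (PI * a)%R by ring.
rewrite Ropp_involutive, cos_neg, sin_neg.
apply C_eq; simpl; lra.
Qed.

Lemma is_lim_seq_inv_sqrt (c : R) : is_lim_seq (fun n => (c / sqrt (INR (2 * n + 2)))%R) 0%R.
Proof.
replace 0%R with (c * 0)%R by ring.
apply (is_lim_seq_mult' (fun _ => c)); [apply is_lim_seq_const|].
apply (is_lim_seq_inv _ p_infty); [|discriminate].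
apply (filterlim_comp _ _ _ (fun n => INR (2 * n + 2)) sqrt _ (Rbar_locally p_infty));
  [|apply filterlim_sqrt_p].
apply is_lim_seq_le_p_loc with INR; [|apply is_lim_seq_INR].
exists 0%nat. intros n _. apply le_INR. lia.
Qed.

(** The weight [exp (2 i z t)] equals [1] at [t = 0], where the mass concentrates. The [16 M]
    collects [8 M] from each component. *)
Lemma cos_moment_cv z :
  is_Clim (fun n => cos_moment z (2 * n) / wallis (2 * n)) 1.
Proof.
set (M := (exp (PI * Rabs (Im z)) * (2 * (Rabs (Re z) + Rabs (Im z))))%R).
assert (HM : (0 <= M)%R).
{ apply Rmult_le_pos; [left; apply exp_pos|].
  generalize (Rabs_pos (Re z)) (Rabs_pos (Im z)). lra. }
apply is_Clim_le with (fun n => (16 * M / sqrt (INR (2 * n + 2)))%R);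
  [|apply is_lim_seq_inv_sqrt].
exists 0%nat. intros n _.
destruct z as [a b]. unfold cos_moment, Re, Im in *; cbn [fst snd] in *.
assert (Habs : forall x y, (Rabs x <= 1)%R -> (Rabs y <= 1)%R ->
  (Rabs (2 * (b * x + a * y)) <= 2 * (Rabs a + Rabs b))%R).
{ intros x y Hx Hy. rewrite Rabs_mult, (Rabs_pos_eq 2) by lra.
  apply Rmult_le_compat_l; [lra|]. eapply Rle_trans; [apply Rabs_triang|].
  rewrite !Rabs_mult. generalize (Rabs_pos a) (Rabs_pos b). nra. }
assert (Cb : forall t, (Rabs (cos t) <= 1)%R) by (intros; apply Rabs_le, COS_bound).
assert (Sb : forall t, (Rabs (sin t) <= 1)%R) by (intros; apply Rabs_le, SIN_bound).
set (f := fun t => (exp (- 2 * b * t) * cos (2 * a * t))%R).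
set (g := fun t => (exp (- 2 * b * t) * sin (2 * a * t))%R).
assert (f0 : f 0%R = 1%R) by (unfold f; rewrite !Rmult_0_r, exp_0, cos_0; ring).
assert (g0 : g 0%R = 0%R) by (unfold g; rewrite !Rmult_0_r, sin_0; ring).
assert (B1 := cos_moment_concentration f 1 M (2 * n)).
assert (B2 := cos_moment_concentration g 0 M (2 * n)).
assert (B1' := B1 ltac:(intros; unfold f; auto_derive; auto) HM). clear B1.
assert (B2' := B2 ltac:(intros; unfold g; auto_derive; auto) HM). clear B2.
assert (W := wallis_even_pos n). set (w := wallis (2 * n)) in *.
set (s := sqrt (INR (2 * n + 2))) in *.
assert (Hs : (0 < s)%R) by (apply sqrt_lt_R0, lt_0_INR; lia).
assert (B1 : (Rabs (cos_moment_re a b (2 * n) - 1 * w) <= 8 * M / s * w)%R).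
{ apply B1'. rewrite <- f0.
  apply exp_trig_lipschitz with
    (fun t => (exp (- 2 * b * t) * - (2 * (b * cos (2 * a * t) + a * sin (2 * a * t))))%R).
  - intros t. unfold f. auto_derive; [exact I|ring].
  - intros t. auto_derive; auto.
  - intros t. rewrite Rabs_mult, Rabs_Ropp, (Rabs_pos_eq (exp _)) by (left; apply exp_pos).
    apply Rmult_le_compat_l; [left; apply exp_pos|]. apply Habs; auto. }
assert (B2 : (Rabs (cos_moment_im a b (2 * n) - 0 * w) <= 8 * M / s * w)%R).
{ apply B2'. rewrite <- g0.
  apply exp_trig_lipschitz with
    (fun t => (exp (- 2 * b * t) * (2 * (b * - sin (2 * a * t) + a * cos (2 * a * t))))%R).
  - intros t. unfold g. auto_derive; [exact I|ring].
  - intros t. auto_derive; auto.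
  - intros t. rewrite Rabs_mult, (Rabs_pos_eq (exp _)) by (left; apply exp_pos).
    apply Rmult_le_compat_l; [left; apply exp_pos|]. apply Habs; auto.
    rewrite Rabs_Ropp. auto. }
set (p := cos_moment_re a b (2 * n)) in *. set (q := cos_moment_im a b (2 * n)) in *.
assert (Nw : RtoC w <> 0) by (apply RtoC_neq_0; lra).
replace ((p, q) / w - 1) with (((p - 1 * w)%R, (q - 0 * w)%R) / w)
  by (unfold Cdiv; apply C_eq; simpl; field; lra).
rewrite Cmod_div, Cmod_R, Rabs_pos_eq by (auto; lra).
apply Rle_div_l; [assumption|].
eapply Rle_trans; [apply Cmod_le_abs|]. simpl Re; simpl Im.
replace (16 * M / s * w)%R with (8 * M / s * w + 8 * M / s * w)%R by (field; lra). lra.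
Qed.

(** * The reflection formula *)

(** Dividing the recurrence for [z] by that of [wallis], with [2 n + 2 = 2 m], shows that one step
    contributes [(4 m^2 - 4 z^2) / (4 m^2)]. *)
Lemma cos_moment_ratio_product z n :
  cos_moment z 0 / PI
  = Cprod (fun i => 1 - z * z / (INR (S i) * INR (S i))) n
    * (cos_moment z (2 * n) / wallis (2 * n)).
Proof.
induction n.
- simpl Cprod. rewrite Nat.mul_0_r, wallis_0. ring.
- rewrite IHn. cbn [Cprod]. rewrite <- Cmult_assoc. f_equal.
  replace (2 * S n)%nat with (2 * n + 2)%nat by lia.
  assert (H1 := cos_moment_rec z (2 * n)). assert (H2 := wallis_rec (2 * n)).
  assert (W1 := wallis_even_pos n). assert (W2 := wallis_even_pos (S n)).
  replace (2 * S n)%nat with (2 * n + 2)%nat in W2 by lia.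
  assert (P1 : (0 < INR (2 * n + 1))%R) by (apply lt_0_INR; lia).
  assert (PS : (0 < INR (S n))%R) by (apply lt_0_INR; lia).
  assert (E2 : INR (2 * n + 2) = (2 * INR (S n))%R)
    by (rewrite S_INR, plus_INR, mult_INR; simpl; ring).
  rewrite E2 in *.
  set (J := cos_moment z (2 * n)) in *. set (J' := cos_moment z (2 * n + 2)) in *.
  set (w := wallis (2 * n)) in *. set (w' := wallis (2 * n + 2)) in *.
  set (m := INR (S n)) in *. set (h := INR (2 * n + 1)) in *.
  assert (H2' : h * w = 2 * m * w') by (rewrite <- !RtoC_mult; f_equal; exact H2).
  rewrite RtoC_mult in H1.
  assert (Nw : RtoC w <> 0) by (apply RtoC_neq_0; lra).
  assert (Nw' : RtoC w' <> 0) by (apply RtoC_neq_0; lra).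
  assert (Nm : RtoC m <> 0) by (apply RtoC_neq_0; lra).
  assert (Nh : RtoC h <> 0) by (apply RtoC_neq_0; lra).
  assert (N2 : RtoC 2 <> 0) by (apply RtoC_neq_0; lra).
  replace (RtoC w) with (2 * m * w' / h) by (rewrite <- H2'; field; exact Nh).
  replace J with ((2 * m * (2 * m) - 4 * z * z) * J' / (2 * m * h))
    by (rewrite <- H1; field; auto).
  field. auto.
Qed.

(** Factors pair up as [(j + z) (j - z) = j^2 (1 - z^2 / j^2)] for [1 <= j <= n], leaving [z] and
    [n + 1 - z]; the two powers of [n] multiply to [n]. *)
Lemma gauss_seq_reflection z n : (1 <= n)%nat -> not_pole z -> not_pole (1 - z) ->
  gauss_seq z n * gauss_seq (1 - z) n
   * (z * Cprod (fun i => 1 - z * z / (INR (S i) * INR (S i))) n)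
  = INR n / (INR n + (1 - z)).
Proof.
intros Hn Hz Hz'. unfold gauss_seq.
assert (Z0 : z <> 0) by (intros ->; apply (Hz 0%nat); simpl; ring).
assert (E : Cprod (fun i => z + INR i) (S n) * Cprod (fun i => 1 - z + INR i) (S n)
  = z * (INR n + (1 - z)) * (INR (fact n) * INR (fact n))
    * Cprod (fun i => 1 - z * z / (INR (S i) * INR (S i))) n).
{ rewrite Cprod_S_l. change (INR 0) with 0%R. rewrite Cplus_0_r.
  change (Cprod (fun i => 1 - z + INR i) (S n))
    with (Cprod (fun i => 1 - z + INR i) n * (1 - z + INR n)).
  assert (F : forall m, Cprod (fun i => z + INR (S i)) m * Cprod (fun i => 1 - z + INR i) m
    = INR (fact m) * INR (fact m) * Cprod (fun i => 1 - z * z / (INR (S i) * INR (S i))) m).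
  { induction m; [simpl; ring|]. cbn [Cprod].
    transitivity ((Cprod (fun i => z + INR (S i)) m * Cprod (fun i => 1 - z + INR i) m)
      * ((z + INR (S m)) * (1 - z + INR m))); [ring|].
    rewrite IHm, fact_simpl, mult_INR, RtoC_mult.
    assert (RtoC (INR (S m)) <> 0) by (apply RtoC_neq_0, not_0_INR; lia).
    replace (1 - z + INR m) with (INR (S m) - z) by (rewrite S_INR, RtoC_plus; ring).
    field. auto. }
  transitivity (z * (1 - z + INR n) * (Cprod (fun i => z + INR (S i)) n * Cprod (fun i => 1 - z + INR i) n));
    [ring|]. rewrite F. ring. }
assert (N1 : Cprod (fun i => z + INR i) (S n) <> 0)
  by (apply Cprod_neq_0; intros; apply not_pole_neq_0, Hz).
assert (N2 : Cprod (fun i => 1 - z + INR i) (S n) <> 0)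
  by (apply Cprod_neq_0; intros; apply not_pole_neq_0, Hz').
assert (N3 : INR n + (1 - z) <> 0) by (rewrite Cplus_comm; apply not_pole_neq_0, Hz').
assert (Nf := INR_fact_neq_0C n).
rewrite Cpower_minus, Cpower_1 by (apply lt_0_INR; lia).
assert (Np := Cpower_neq_0 (INR n) z).
set (P := Cprod (fun i => 1 - z * z / (INR (S i) * INR (S i))) n) in *.
transitivity (INR n / (INR n + (1 - z)) *
  ((z * (INR n + (1 - z)) * (INR (fact n) * INR (fact n)) * P)
   / (Cprod (fun i => z + INR i) (S n) * Cprod (fun i => 1 - z + INR i) (S n)))).
- field. auto.
- rewrite <- E. field. auto.
Qed.

(** Keeping the sine as a factor, not a divisor, means that its nonvanishing is a consequence and
    need not be shown beforehand. *)
Lemma CGamma_reflection z : not_pole z -> not_pole (1 - z) ->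
  CGamma z * CGamma (1 - z) * Csin (PI * z) = PI.
Proof.
intros Hz Hz'.
assert (NPI : RtoC PI <> 0) by (apply RtoC_neq_0, PI_neq0).
assert (E : CGamma z * CGamma (1 - z) * (z * (cos_moment z 0 / PI)) = 1 * 1).
{ apply is_Clim_unique with
    (fun n => gauss_seq z n * gauss_seq (1 - z) n * (z * (cos_moment z 0 / PI))).
  - apply is_Clim_mult; [apply is_Clim_mult; apply is_Clim_gauss_seq; assumption
                        |apply is_Clim_const].
  - eapply is_Clim_ext_from with (N := 1%nat);
      [|apply is_Clim_mult; [apply (is_Clim_INR_ratio (1 - z))|apply (cos_moment_cv z)]].
    intros n Hn; cbv beta. rewrite (cos_moment_ratio_product z n).
    rewrite <- gauss_seq_reflection by assumption. ring. }
rewrite <- cos_moment_0.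
replace (CGamma z * CGamma (1 - z) * (z * cos_moment z 0))
  with (CGamma z * CGamma (1 - z) * (z * (cos_moment z 0 / PI)) * PI) by (field; exact NPI).
rewrite E. ring.
Qed.

(** * Stirling's formula *)

(** This is [n! e^n / n^(n + 1/2)]; the single exponential makes it positive at every [n], [0]
    included. *)
Definition stirling (n : nat) : R :=
  (INR (fact n) * exp (INR n - (INR n + / 2) * ln (INR n)))%R.

(* [ln (1 + x) - 2 x / (2 + x)] has derivative [x^2 / ((1 + x) (2 + x)^2)]. *)
Lemma ln_one_plus_second_order (x : R) : (0 < x)%R ->
  (0 <= ln (1 + x) - 2 * x / (2 + x) <= x ^ 3 / 4)%R.
Proof.
intros Hx.
destruct (MVT_gen (fun t => ln (1 + t) - 2 * t / (2 + t))%R 0 x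
  (fun t => t ^ 2 / ((1 + t) * (2 + t) ^ 2))%R) as [c [Hc E]];
  rewrite ?Rmin_left, ?Rmax_right in * by lra.
- intros t Ht. auto_derive; [repeat split; try lra|]. field. lra.
- intros t Ht. apply continuity_pt_filterlim.
  apply (ex_derive_continuous (fun t => ln (1 + t) - 2 * t / (2 + t))%R).
  auto_derive; repeat split; lra.
- rewrite Rplus_0_r, ln_1 in E. replace (0 - 2 * 0 / (2 + 0))%R with 0%R in E by field.
  rewrite !Rminus_0_r in E. rewrite E.
  assert (P : (4 <= (1 + c) * (2 + c) ^ 2)%R) by (simpl; nra).
  assert (Q : (0 <= c ^ 2 <= x ^ 2)%R) by (split; [apply pow2_ge_0|apply pow_incr; lra]).
  assert (B : (0 <= c ^ 2 / ((1 + c) * (2 + c) ^ 2) <= x ^ 2 / 4)%R).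
  { split; [apply Rle_div_r; lra|]. apply Rle_div_l; [lra|].
    assert (0 <= x ^ 2 / 4)%R by lra. nra. }
  split; [nra|]. replace (x ^ 3 / 4)%R with (x ^ 2 / 4 * x)%R by field. nra.
Qed.

Lemma stirling_pos n : (0 < stirling n)%R.
Proof. apply Rmult_lt_0_compat; [apply INR_fact_lt_0|apply exp_pos]. Qed.

(** The ratio of consecutive terms is [exp (1 - (n + 1/2) h)]. At [x = 1/n] the approximation
    [2 x / (2 + x)] of [h] is exactly [1 / (n + 1/2)], so only a term of order [1/n^2] survives and
    the complex ratio criterion applies. *)
Lemma stirling_cv : exists s : R, is_lim_seq stirling s /\ (0 < s)%R.
Proof.
destruct (ex_Clim_ratio_neq_0 (fun n => RtoC (stirling n)) 1 1) as [l [[Hr Hi] Nl]].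
- lia.
- lra.
- intros. apply RtoC_neq_0. generalize (stirling_pos n). lra.
- intros n Hn.
  assert (N0 : (1 <= INR n)%R) by (apply (le_INR 1); lia).
  assert (NS : INR (S n) = (INR n + 1)%R) by apply S_INR.
  set (h := (ln (INR (S n)) - ln (INR n))%R).
  assert (E : (stirling (S n) / stirling n = exp (1 - (INR n + / 2) * h))%R).
  { unfold stirling. rewrite fact_simpl, mult_INR.
    assert (F := INR_fact_lt_0 n).
    replace (1 - (INR n + / 2) * h)%R with
      ((INR (S n) - (INR (S n) + / 2) * ln (INR (S n))) + ln (INR (S n))
       + - (INR n - (INR n + / 2) * ln (INR n)))%R by (unfold h; rewrite NS; ring).
    rewrite !exp_plus, exp_Ropp, exp_ln by lra.
    field. split; [|lra]. apply Rgt_not_eq, exp_pos. }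
  rewrite <- RtoC_div by (generalize (stirling_pos n); lra).
  rewrite E, <- RtoC_minus, Cmod_R, Rmult_1_l.
  assert (Hx : (0 < / INR n)%R) by (apply Rinv_0_lt_compat; lra).
  assert (L := ln_one_plus_second_order (/ INR n) Hx).
  replace (ln (1 + / INR n)) with h in L.
  2:{ unfold h. rewrite <- ln_div by lra. f_equal. rewrite NS. field. lra. }
  replace (2 * / INR n / (2 + / INR n))%R with (/ (INR n + / 2))%R in L by (field; lra).
  replace (/ INR n - / INR (S n))%R with (/ INR n * / (INR n + 1))%R by (rewrite NS; field; lra).
  set (w := (1 - (INR n + / 2) * h)%R).
  assert (W : (0 <= - w <= (INR n + / 2) * ((/ INR n) ^ 3 / 4))%R).
  { replace (- w)%R with ((INR n + / 2) * (h - / (INR n + / 2)))%R by (unfold w; field; lra).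
    split; [apply Rmult_le_pos; lra|apply Rmult_le_compat_l; lra]. }
  assert (W2 : ((INR n + / 2) * ((/ INR n) ^ 3 / 4) <= / INR n * / (INR n + 1))%R).
  { apply Rmult_le_reg_r with (4 * INR n ^ 3 * (INR n + 1))%R;
      [repeat apply Rmult_lt_0_compat; lra|].
    replace ((INR n + / 2) * ((/ INR n) ^ 3 / 4) * (4 * INR n ^ 3 * (INR n + 1)))%R
      with ((INR n + / 2) * (INR n + 1))%R by (field; lra).
    replace (/ INR n * / (INR n + 1) * (4 * INR n ^ 3 * (INR n + 1)))%R
      with (4 * INR n ^ 2)%R by (field; lra). nra. }
  assert (exp w <= 1)%R by (rewrite <- exp_0; apply exp_le_exp; lra).
  generalize (exp_ineq1_le w). intros. apply Rabs_le. lra.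
- simpl in Hr, Hi. exists (Re l). split; [exact Hr|].
  assert (I : Im l = 0%R).
  { generalize (is_lim_seq_unique _ _ Hi). rewrite Lim_seq_const. intros T.
    injection T. auto. }
  assert (P : (0 <= Re l)%R).
  { apply (is_lim_seq_le (fun _ => 0%R) stirling 0%R (Re l));
      [|apply is_lim_seq_const|exact Hr]. intros n. left. apply stirling_pos. }
  destruct P as [P|P]; [exact P|]. exfalso. apply Nl. apply C_eq; simpl; auto.
Qed.

(** * The multiplication formula *)

Lemma Cprod_Cpower_arith (c : R) (z h : C) m :
  Cprod (fun r => Cpower c (z + INR r * h)) m
  = Cpower c (INR m * z + h * (INR m * (INR m - 1) / 2)).
Proof.
assert (N2 : RtoC 2 <> 0) by (apply RtoC_neq_0; lra).
induction m.
- change (INR 0) with 0%R. rewrite !Cmult_0_l.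
  replace (0 + h * (0 / 2)) with (RtoC 0) by field.
  rewrite Cpower_0. reflexivity.
- cbn [Cprod]. rewrite IHm, <- Cpower_plus. f_equal.
  rewrite S_INR, RtoC_plus. field.
Qed.

(** Euclidean division [j = m i + r] sorts the factors: [m (z + r/m + i) = m z + j]. *)
Lemma Cprod_blocks (z : C) m q : (1 <= m)%nat ->
  Cprod (fun r => Cprod (fun i => z + INR r / INR m + INR i) q) m * INR m ^ (m * q)
  = Cprod (fun j => INR m * z + INR j) (m * q).
Proof.
intros Hm.
assert (Nm : RtoC (INR m) <> 0) by (apply RtoC_neq_0, not_0_INR; lia).
rewrite Cprod_exchange. induction q.
- rewrite Nat.mul_0_r. simpl. ring.
- replace (m * S q)%nat with (m * q + m)%nat by lia.
  rewrite Cprod_add, <- IHq, Cpow_add_r. cbn [Cprod].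
  rewrite <- (Cprod_const (INR m) m) at 1.
  rewrite (Cprod_ext (fun i => INR m * z + INR (m * q + i))
    (fun r => (z + INR r / INR m + INR q) * INR m)).
  2:{ intros. rewrite plus_INR, mult_INR, RtoC_plus, RtoC_mult. field. exact Nm. }
  rewrite (Cprod_mult (fun r => z + INR r / INR m + INR q)). ring.
Qed.

(** Since the powers of [n] have exponents [z + r/m], they multiply to [n^(m z)] times
    [n^((m-1)/2)]. Beyond the Gauss term at [m z], the dependence on [z] is confined to one power,
    with base tending to [1/m]. *)
Lemma gauss_seq_multiplication (z : C) m n : (1 <= m)%nat -> (1 <= n)%nat ->
  (forall r, (r < m)%nat -> not_pole (z + INR r / INR m)) -> not_pole (INR m * z) ->
  Cprod (fun r => gauss_seq (z + INR r / INR m) n) m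
  = gauss_seq (INR m * z) (m * S n - 1)
    * Cpower (INR n / INR (m * S n - 1)) (INR m * z)
    * (INR (fact n) ^ m * Rpower (INR n) ((INR m - 1) / 2) * INR m ^ (m * S n)
        / INR (fact (m * S n - 1)))%R.
Proof.
intros Hm Hn Hz Hmz.
assert (Nm : RtoC (INR m) <> 0) by (apply RtoC_neq_0, not_0_INR; lia).
assert (N2 : RtoC 2 <> 0) by (apply RtoC_neq_0; lra).
(* Each of the [m] products has [n + 1] factors, and the Gauss term of index [N] has [N + 1]. *)
set (N := (m * S n - 1)%nat).
assert (HN : (1 <= N)%nat) by (unfold N; nia).
assert (En : (0 < INR n)%R) by (apply lt_0_INR; lia).
assert (EN : (0 < INR N)%R) by (apply lt_0_INR; lia).
assert (B := Cprod_blocks z m (S n) Hm).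
replace (m * S n)%nat with (S N) in * by (unfold N; nia).
unfold gauss_seq.
set (D := fun r => Cprod (fun i => z + INR r / INR m + INR i) (S n)) in *.
assert (ND : Cprod D m <> 0).
{ apply Cprod_neq_0. intros r Hr. apply Cprod_neq_0. intros. apply not_pole_neq_0, Hz, Hr. }
assert (E : Cprod (fun r => INR (fact n) * Cpower (INR n) (z + INR r / INR m)
     / D r) m * Cprod D m = INR (fact n) ^ m * (Cpower (INR n) (INR m * z) * Rpower (INR n) ((INR m - 1) / 2))).
{ rewrite <- Cprod_mult, <- Cprod_const.
  replace (Cpower (INR n) (INR m * z) * Rpower (INR n) ((INR m - 1) / 2)) with
    (Cprod (fun r => Cpower (INR n) (z + INR r * / INR m)) m).
  - rewrite <- Cprod_mult. apply Cprod_ext. intros r Hr. cbv beta.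
    change (z + INR r * / INR m) with (z + INR r / INR m). field.
    apply Cprod_neq_0. intros. apply not_pole_neq_0, Hz, Hr.
  - rewrite Cprod_Cpower_arith, Cpower_plus, <- Cpower_RtoC. f_equal. f_equal.
    rewrite RtoC_div, RtoC_minus by lra. field. auto. }
set (P := Cprod (fun j => INR m * z + INR j) (S N)) in *.
assert (NP : P <> 0) by (apply Cprod_neq_0; intros; apply not_pole_neq_0, Hmz).
assert (E' : Cprod (fun r => INR (fact n) * Cpower (INR n) (z + INR r / INR m) / D r) m
  = INR (fact n) ^ m * (Cpower (INR n) (INR m * z) * Rpower (INR n) ((INR m - 1) / 2)) / Cprod D m)
  by (rewrite <- E; field; exact ND).
change (Cprod (fun r => INR (fact n) * Cpower (INR n) (z + INR r / INR m) / D r) m =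
  INR (fact N) * Cpower (INR N) (INR m * z) / P *
  Cpower (INR n / INR N) (INR m * z) *
  (INR (fact n) ^ m * Rpower (INR n) ((INR m - 1) / 2) * INR m ^ S N / INR (fact N))%R).
rewrite E', Cpower_div_base by assumption.
rewrite RtoC_div by apply INR_fact_neq_0.
rewrite !RtoC_mult, !RtoC_pow.
assert (ND' : Cprod D m * INR m ^ S N <> 0) by (rewrite B; exact NP).
rewrite <- B. field. repeat split;
  first [exact ND|apply INR_fact_neq_0C|apply Cpower_neq_0|apply Cpow_nz, Nm].
Qed.

Lemma fact_stirling n : (1 <= n)%nat ->
  INR (fact n) = (stirling n * exp ((INR n + / 2) * ln (INR n) - INR n))%R.
Proof.
intros Hn. unfold stirling. rewrite Rmult_assoc, <- exp_plus.
replace (_ + _)%R with 0%R by ring. rewrite exp_0. ring.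
Qed.

Lemma multiplication_constant_stirling m n : (1 <= m)%nat -> (1 <= n)%nat ->
  (INR (fact n) ^ m * Rpower (INR n) ((INR m - 1) / 2) * INR m ^ (m * S n)
        / INR (fact (m * S n - 1))
   = stirling (S n) ^ m / stirling (m * S n)
     * (sqrt (INR m) * Rpower (INR n / INR (S n)) ((INR m - 1) / 2)))%R.
Proof.
intros Hm Hn.
assert (Pm : (0 < INR m)%R) by (apply lt_0_INR; lia).
assert (Pn : (0 < INR n)%R) by (apply lt_0_INR; lia).
assert (PS : (0 < INR (S n))%R) by (apply lt_0_INR; lia).
(* Passing to [(n + 1)!] and [(m (n + 1))!] makes the two arguments proportional, so that the
   exponentials and the powers of [n + 1] cancel. *)
assert (F1 : INR (fact n) = (INR (fact (S n)) / INR (S n))%R).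
{ rewrite fact_simpl, mult_INR. field. lra. }
assert (F2 : INR (fact (m * S n - 1)) = (INR (fact (m * S n)) / (INR m * INR (S n)))%R).
{ replace (m * S n)%nat with (S (m * S n - 1)) at 2 by nia.
  rewrite fact_simpl, mult_INR.
  replace (S (m * S n - 1)) with (m * S n)%nat by nia. rewrite mult_INR. field. lra. }
rewrite F1, F2, !fact_stirling by nia.
rewrite mult_INR.
set (M := INR (S n)) in *. set (s1 := stirling (S n)). set (s2 := stirling (m * S n)).
assert (P1 : (0 < s1)%R) by apply stirling_pos.
assert (P2 : (0 < s2)%R) by apply stirling_pos.
assert (Q : forall c k, (0 < c)%R -> (c ^ k = exp (INR k * ln c))%R).
{ intros c k Hc. rewrite <- Rpower_pow by assumption. reflexivity. }
rewrite (Q _ (m * S n)%nat) by assumption.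
replace (s1 * exp ((M + / 2) * ln M - M) / M)%R
  with (s1 * exp ((M + / 2) * ln M - M + - ln M))%R
  by (rewrite exp_plus, exp_Ropp, exp_ln by assumption; unfold Rdiv; ring).
rewrite Rpow_mult_distr, (Q (exp _)), ln_exp by apply exp_pos.
rewrite mult_INR. fold M.
rewrite ln_mult by assumption.
assert (S1 : sqrt (INR m) = exp (/ 2 * ln (INR m))) by (rewrite <- Rpower_sqrt by assumption; reflexivity).
unfold Rpower. rewrite ln_div, S1 by assumption.
set (e2 := exp ((INR m * M + / 2) * (ln (INR m) + ln M) - INR m * M)).
assert (E2 : (/ (s2 * e2 / (INR m * M)) = / s2 * (exp (ln (INR m)) * exp (ln M) * exp (- ((INR m * M + / 2) * (ln (INR m) + ln M) - INR m * M))))%R).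
{ rewrite !exp_ln, exp_Ropp by assumption. fold e2. field. repeat split; try lra.
  unfold e2. apply Rgt_not_eq, exp_pos. }
unfold Rdiv at 1. rewrite E2.
rewrite <- !exp_plus.
match goal with |- (s1 ^ m * exp ?a * exp ?b * exp ?c * (/ s2 * exp ?d) = _ * exp ?e)%R =>
  transitivity (s1 ^ m / s2 * exp (a + b + c + d))%R;
  [rewrite !exp_plus; field; lra|f_equal; f_equal; field] end.
Qed.

Lemma is_lim_seq_ratio_affine (m : nat) : (1 <= m)%nat ->
  is_lim_seq (fun n => INR n / INR (m * S n - 1))%R (/ INR m)%R.
Proof.
intros Hm.
assert (Pm : (1 <= INR m)%R) by (apply (le_INR 1); lia).
assert (L : is_Clim (fun n => / INR m * (INR n / (INR n + ((INR m - 1) / INR m)%R))) (/ INR m * 1))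
  by (apply is_Clim_mult; [apply is_Clim_const|apply is_Clim_INR_ratio]).
rewrite Cmult_1_r, <- RtoC_inv in L by lra.
destruct L as [L _]. simpl in L.
eapply is_lim_seq_ext_loc; [|exact L]. exists 1%nat. intros n Hn. cbv beta.
assert (Pn : (1 <= INR n)%R) by (apply (le_INR 1); lia).
rewrite minus_INR, mult_INR, S_INR by nia. change (INR 1) with 1%R.
assert (0 < INR m * INR n)%R by nra.
assert (0 <= (INR m - 1) / INR m)%R by (apply Rle_div_r; lra).
field. simpl. repeat split; nra.
Qed.

(** The value of [s] is left open because [stirling_limit] is deduced from this formula. The power
    [m - 1] comes from [m] Stirling factors above and one below. *)
Lemma CGamma_multiplication_stirling (s : R) (z : C) m : (1 <= m)%nat ->
  is_lim_seq stirling s -> (0 < s)%R ->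
  (forall r, (r < m)%nat -> not_pole (z + INR r / INR m)) -> not_pole (INR m * z) ->
  Cprod (fun r => CGamma (z + INR r / INR m)) m
  = CGamma (INR m * z) * Cpower (/ INR m) (INR m * z) * (s ^ (m - 1) * sqrt (INR m))%R.
Proof.
intros Hm Hs Ps Hz Hmz.
assert (Pm : (1 <= INR m)%R) by (apply (le_INR 1); lia).
apply is_Clim_unique with (fun n => Cprod (fun r => gauss_seq (z + INR r / INR m) n) m).
- apply (is_Clim_Cprod (fun n r => gauss_seq (z + INR r / INR m) n)).
  intros r Hr. apply is_Clim_gauss_seq, Hz, Hr.
- eapply is_Clim_ext_from with (N := 1%nat).
  { intros n Hn. symmetry. apply gauss_seq_multiplication; assumption. }
  apply is_Clim_mult; [apply is_Clim_mult|].
  + apply (is_Clim_subseq (fun n => (m * S n - 1)%nat)); [|apply is_Clim_gauss_seq, Hmz].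
    intros N. exists N. intros. nia.
  + unfold Cpower. apply is_Clim_Cexp, is_Clim_mult; [apply is_Clim_const|].
    apply is_Clim_RtoC, (is_lim_seq_continuous ln).
    * apply continuity_pt_filterlim, (continuous_ln). apply Rinv_0_lt_compat. lra.
    * apply is_lim_seq_ratio_affine, Hm.
  + apply is_Clim_RtoC.
    eapply is_lim_seq_ext_loc.
    { exists 1%nat. intros n Hn. symmetry. apply multiplication_constant_stirling; assumption. }
    replace (s ^ (m - 1) * sqrt (INR m))%R with (s ^ m / s * (sqrt (INR m) * Rpower 1 ((INR m - 1) / 2)))%R.
    2:{ unfold Rpower. rewrite ln_1, Rmult_0_r, exp_0.
        replace m with (S (m - 1)) at 1 by lia. simpl. field. lra. }
    apply is_lim_seq_mult'; [apply is_lim_seq_div'|apply is_lim_seq_mult'].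
    * assert (P : forall k, is_lim_seq (fun n => stirling (S n) ^ k)%R (s ^ k)%R).
      { induction k; simpl; [apply is_lim_seq_const|].
        apply is_lim_seq_mult'; [apply is_lim_seq_incr_1 in Hs; exact Hs|exact IHk]. }
      apply P.
    * apply (is_lim_seq_subseq stirling s (fun n => (m * S n)%nat)); [|exact Hs].
      intros P [N HN]. exists N. intros. apply HN. nia.
    * lra.
    * apply is_lim_seq_const.
    * unfold Rpower.
      apply (is_lim_seq_continuous exp (fun n => (INR m - 1) / 2 * ln (INR n / INR (S n)))%R).
      { apply derivable_continuous_pt, derivable_pt_exp. }
      apply is_lim_seq_mult'; [apply is_lim_seq_const|].
      apply (is_lim_seq_continuous ln); [apply continuity_pt_filterlim, continuous_ln; lra|].
      apply (is_lim_seq_incr_1 (fun n => INR n / INR (S n))%R).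
      assert (L2 : is_Clim (fun n => INR n / (INR n + 1)) 1) by apply is_Clim_INR_ratio.
      destruct L2 as [L2 _]. apply is_lim_seq_incr_1 in L2.
      change (Re 1) with 1%R in L2.
      eapply is_lim_seq_ext; [|exact L2]. intros n. cbv beta.
      rewrite <- RtoC_plus, <- RtoC_div; [rewrite <- S_INR; reflexivity|].
      generalize (pos_INR (S n)); lra.
Qed.

Lemma Csin_RtoC (r : R) : Csin r = sin r.
Proof.
unfold Csin, Cexp. apply C_eq; simpl;
  replace (0 * r - 1 * 0)%R with 0%R by ring;
  replace (0 * 0 + 1 * r)%R with r by ring;
  rewrite ?Ropp_0, ?exp_0, ?cos_neg, ?sin_neg; field.
Qed.

(** For [m = 2] and [z = 1/2] both sides contain [CGamma 1 = 1], whence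
    [CGamma (1/2) = s sqrt 2 / 2]; reflection at [1/2] says that its square is [PI]. *)
Lemma stirling_limit : is_lim_seq stirling (sqrt (2 * PI))%R.
Proof.
destruct stirling_cv as [s [Hs Ps]].
assert (Hz : forall r, (r < 2)%nat -> not_pole ((1/2)%R + INR r / INR 2)).
{ intros r _. apply not_pole_Re_pos. rewrite <- RtoC_div, <- RtoC_plus by (simpl; lra).
  simpl. generalize (pos_INR r). intros. lra. }
assert (H2 : INR 2 * (1 / 2)%R = 1) by (rewrite <- RtoC_mult; f_equal; simpl; field).
assert (Hm : not_pole (INR 2 * (1/2)%R)).
{ rewrite H2. apply not_pole_Re_pos. simpl; lra. }
assert (E := CGamma_multiplication_stirling s (1/2)%R 2 ltac:(lia) Hs Ps Hz Hm).
rewrite H2, CGamma_1 in E. cbn [Cprod] in E.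
replace ((1 / 2)%R + INR 0 / INR 2) with (RtoC (1/2)) in E
  by (rewrite <- RtoC_div, <- RtoC_plus by (simpl; lra); f_equal; simpl; field).
replace ((1 / 2)%R + INR 1 / INR 2) with (RtoC 1) in E
  by (rewrite <- RtoC_div, <- RtoC_plus by (simpl; lra); f_equal; simpl; field).
rewrite CGamma_1, Cpower_1 in E by (apply Rinv_0_lt_compat; simpl; lra).
assert (R : CGamma (1/2)%R * CGamma (1 - (1/2)%R) * Csin (PI * (1/2)%R) = PI).
{ apply CGamma_reflection; apply not_pole_Re_pos; simpl; lra. }
replace (1 - (1/2)%R) with (RtoC (1/2)) in R by (rewrite <- RtoC_minus; f_equal; field).
rewrite <- RtoC_mult, Csin_RtoC in R. replace (PI * (1/2))%R with (PI/2)%R in R by field.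
rewrite sin_PI2 in R.
assert (G : CGamma (1/2)%R = (/ 2 * (s * sqrt 2))%R).
{ rewrite !Cmult_1_l, Cmult_1_r, <- RtoC_mult in E. rewrite E. f_equal. simpl.
  replace (1 + 1)%R with 2%R by ring. ring. }
rewrite G, <- !RtoC_mult in R. apply RtoC_inj in R.
assert (T : sqrt 2 * sqrt 2 = 2%R) by (rewrite <- RtoC_mult; f_equal; apply sqrt_sqrt; lra).
rewrite <- RtoC_mult in T. apply RtoC_inj in T.
replace (sqrt (2 * PI)) with s; [exact Hs|].
symmetry. apply sqrt_lem_1; [generalize PI_RGT_0; lra|lra|].
transitivity (2 * (/ 2 * (s * sqrt 2) * (/ 2 * (s * sqrt 2)) * 1))%R; [|rewrite R; reflexivity].
transitivity (s * s * (sqrt 2 * sqrt 2) / 2)%R; [rewrite T|]; field.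
Qed.

Lemma CGamma_multiplication (z : C) m : (1 <= m)%nat ->
  (forall r, (r < m)%nat -> not_pole (z + INR r / INR m)) -> not_pole (INR m * z) ->
  Cprod (fun r => CGamma (z + INR r / INR m)) m
  = Rpower (2 * PI) ((INR m - 1) / 2) * Cpower (INR m) (1 / 2 - INR m * z) * CGamma (INR m * z).
Proof.
intros Hm Hz Hmz.
assert (P2 : (0 < 2 * PI)%R) by (generalize PI_RGT_0; lra).
assert (Pm : (0 < INR m)%R) by (apply lt_0_INR; lia).
rewrite (CGamma_multiplication_stirling _ _ _ Hm stirling_limit) by (auto; apply sqrt_lt_R0, P2).
rewrite Cpower_minus.
replace (Cpower (INR m) (1 / 2)) with (RtoC (sqrt (INR m))).
2:{ rewrite <- RtoC_div, Cpower_RtoC by lra. f_equal.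
    rewrite <- Rpower_sqrt by assumption. f_equal. field. }
replace (Cpower (/ INR m) (INR m * z)) with (/ Cpower (INR m) (INR m * z)).
2:{ rewrite <- Cpower_opp. unfold Cpower. f_equal. rewrite ln_Rinv, RtoC_opp by assumption. ring. }
replace (Rpower (2 * PI) ((INR m - 1) / 2)) with (sqrt (2 * PI) ^ (m - 1))%R.
2:{ rewrite <- Rpower_sqrt, <- Rpower_pow, Rpower_mult by (try apply exp_pos; assumption).
    f_equal. rewrite minus_INR by assumption. simpl. field. }
rewrite RtoC_mult. field. apply Cpower_neq_0.
Qed.

(** * Euler's integral *)

Fixpoint rising (s : R) (n : nat) : R :=
  match n with
  | O => 1
  | S n' => rising s n' * (s + INR n')
  end.

Lemma rising_pos s n : (0 < s)%R -> (0 < rising s n)%R.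
Proof.
intros Hs. induction n; simpl; [lra|].
apply Rmult_lt_0_compat; [exact IHn|]. generalize (pos_INR n). lra.
Qed.

Lemma Cprod_rising (s : R) n : Cprod (fun i => s + INR i) n = rising s n.
Proof. induction n; simpl; [reflexivity|]. rewrite IHn, RtoC_mult, RtoC_plus. reflexivity. Qed.

Section EulerIntegral.

Local Open Scope R_scope.

Definition gauss_seq_R (s : R) (n : nat) : R :=
  INR (fact n) * Rpower (INR n) s / rising s (S n).

Lemma gauss_seq_RtoC (s : R) n : 0 < s -> gauss_seq s n = gauss_seq_R s n.
Proof.
intros Hs. unfold gauss_seq, gauss_seq_R.
rewrite Cprod_rising, Cpower_RtoC, RtoC_div, RtoC_mult; [reflexivity|].
apply Rgt_not_eq, rising_pos, Hs.
Qed.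

Lemma gauss_seq_R_cv (s : R) : 0 < s ->
  CGamma s = Re (CGamma s) /\ is_lim_seq (gauss_seq_R s) (Re (CGamma s)).
Proof.
intros Hs.
destruct (is_Clim_gauss_seq s) as [H1 H2]; [apply not_pole_Re_pos, Hs|].
split.
- apply C_eq; [reflexivity|]. simpl.
  assert (T : is_lim_seq (fun _ => 0) (Im (CGamma s))).
  { apply is_lim_seq_ext with (2 := H2). intros n. rewrite gauss_seq_RtoC by exact Hs. reflexivity. }
  generalize (is_lim_seq_unique _ _ T). rewrite Lim_seq_const. intros E. injection E. auto.
- apply is_lim_seq_ext with (2 := H1). intros n. rewrite gauss_seq_RtoC by exact Hs. reflexivity.
Qed.

(** * Truncated Euler integrals and their limits at zero and infinity *)

Definition gamma_integrand (s t : R) : R := Rpower t (s - 1) * exp (- t).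

Definition gamma_partial (s : R) (ab : R * R) : R :=
  RInt (gamma_integrand s) (fst ab) (snd ab).

(** The filter on pairs of endpoints that underlies the [RInt_gen] of [Gamma]. *)
Definition zero_infty : (R * R -> Prop) -> Prop :=
  filter_prod (at_right 0) (Rbar_locally p_infty).

Lemma zero_infty_ordered : zero_infty (fun ab => 0 < fst ab < snd ab).
Proof.
exists (fun a => 0 < a < 1) (fun b => 1 < b).
- exists (mkposreal 1 Rlt_0_1). intros y Hy Hy0. split; [exact Hy0|].
  apply Rabs_lt_between in Hy. unfold minus, plus, opp in Hy; simpl in Hy. lra.
- exists 1. auto.
- simpl. intros; lra.
Qed.

Lemma zero_infty_and P Q : zero_infty P -> zero_infty Q -> zero_infty (fun ab => P ab /\ Q ab).
Proof. apply filter_and. Qed.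

Lemma zero_infty_imp (P Q : R * R -> Prop) : (forall ab, P ab -> Q ab) -> zero_infty P -> zero_infty Q.
Proof. intros H. apply filter_imp, H. Qed.

Definition is_lim_0oo (f : R * R -> R) (l : R) : Prop := filterlim f zero_infty (locally l).

Lemma is_lim_0oo_eps f l :
  is_lim_0oo f l <-> forall eps : posreal, zero_infty (fun ab => Rabs (f ab - l) < eps).
Proof. unfold is_lim_0oo. rewrite filterlim_locally. reflexivity. Qed.

Lemma is_lim_0oo_ext f g l :
  (forall a b, 0 < a -> a < b -> f (a, b) = g (a, b)) -> is_lim_0oo f l -> is_lim_0oo g l.
Proof.
intros H. apply filterlim_ext_loc.
apply zero_infty_imp with (2 := zero_infty_ordered).
intros [a b] [Ha Hb]. apply H; assumption.
Qed.

Lemma is_lim_0oo_plus f g l m :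
  is_lim_0oo f l -> is_lim_0oo g m -> is_lim_0oo (fun ab => f ab + g ab) (l + m).
Proof.
intros Hf Hg. apply (filterlim_comp_2 f g Rplus Hf Hg).
apply (filterlim_plus (V:=R_NormedModule)).
Qed.

Lemma is_lim_0oo_scal c f l : is_lim_0oo f l -> is_lim_0oo (fun ab => c * f ab) (c * l).
Proof.
intros Hf. apply filterlim_comp with (1 := Hf).
apply (filterlim_scal_r (V:=R_NormedModule)).
Qed.

Lemma filterlim_Rpower_0 s : 0 < s -> filterlim (fun a => Rpower a s) (at_right 0) (locally 0).
Proof.
intros Hs. unfold Rpower.
apply (filterlim_comp _ _ _ (fun a => s * ln a) exp _ (Rbar_locally m_infty)).
- apply (filterlim_comp _ _ _ ln (fun y => s * y) _ (Rbar_locally m_infty)); [apply is_lim_ln_0|].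
  generalize (filterlim_Rbar_mult_l s m_infty). simpl.
  destruct (Rle_dec 0 s) as [h|h]; [|lra]. destruct (Rle_lt_or_eq_dec 0 s h); [auto|lra].
- apply is_lim_exp_m.
Qed.

(** The function is [exp (b (s ln b / b - 1))], and [ln b / b] tends to [0]. *)
Lemma filterlim_Rpower_exp_p s :
  filterlim (fun b => Rpower b s * exp (- b)) (Rbar_locally p_infty) (locally 0).
Proof.
apply (is_lim_ext_loc (fun b => exp (b * (s * (ln b / b) - 1))) (fun b => Rpower b s * exp (- b)) p_infty 0).
{ exists 0. intros b Hb. unfold Rpower. rewrite <- exp_plus. f_equal. field. lra. }
apply (is_lim_comp exp (fun b => b * (s * (ln b / b) - 1)) p_infty 0 m_infty).
- apply is_lim_exp_m.
- assert (L : is_lim (fun b => s * (ln b / b) - 1) p_infty (s * 0 - 1)).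
  { apply is_lim_minus'; [|apply is_lim_const].
    apply (is_lim_scal_l (fun b => ln b / b) s p_infty 0), is_lim_div_ln_p. }
  replace (s * 0 - 1) with (-1) in L by ring.
  replace m_infty with (Rbar_mult p_infty (-1))
    by (simpl; destruct (Rle_dec 0 (-1)); [exfalso; lra|reflexivity]).
  apply (is_lim_mult (fun b => b) _ p_infty p_infty (-1)); [apply is_lim_id|exact L|].
  simpl. lra.
- exists 0. intros. discriminate.
Qed.

Lemma filterlim_exp_opp_0 : filterlim (fun a => exp (- a)) (at_right 0) (locally (exp (- 0))).
Proof.
apply (filterlim_filter_le_1 (F := locally 0)).
- intros P [e He]. exists e. auto.
- apply (ex_derive_continuous (fun t => exp (- t))). auto_derive; exact I.
Qed.

Definition gamma_boundary (s : R) (ab : R * R) : R :=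
  Rpower (snd ab) s * exp (- snd ab) - Rpower (fst ab) s * exp (- fst ab).

Lemma gamma_boundary_cv s : 0 < s -> is_lim_0oo (gamma_boundary s) 0.
Proof.
intros Hs. unfold gamma_boundary.
replace 0 with (0 + - (0 * 1)) by ring.
apply (is_lim_0oo_plus (fun ab => Rpower (snd ab) s * exp (- snd ab))
  (fun ab => - (Rpower (fst ab) s * exp (- fst ab)))).
- apply (filterlim_comp _ _ _ snd (fun b => Rpower b s * exp (- b)) _ _ _ filterlim_snd).
  apply filterlim_Rpower_exp_p.
- apply (filterlim_comp _ _ _ fst (fun a => - (Rpower a s * exp (- a))) _ _ _ filterlim_fst).
  apply (filterlim_comp _ _ _ (fun a => Rpower a s * exp (- a)) Ropp _ (locally (0 * 1)));
    [|apply (filterlim_opp (V:=R_NormedModule))].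
  apply (filterlim_comp_2 _ _ Rmult (filterlim_Rpower_0 s Hs) (H := locally 1));
    [|apply (filterlim_mult (K:=R_AbsRing))].
  replace 1 with (exp (- 0)) by (rewrite Ropp_0; apply exp_0).
  apply filterlim_exp_opp_0.
Qed.

Lemma gamma_integrand_continuous s t : 0 < t -> continuous (gamma_integrand s) t.
Proof.
intros Ht. apply (ex_derive_continuous (gamma_integrand s)).
unfold gamma_integrand, Rpower. auto_derive. auto.
Qed.

Lemma ex_RInt_gamma s a b : 0 < a -> a < b -> ex_RInt (gamma_integrand s) a b.
Proof.
intros Ha Hb. apply (ex_RInt_continuous (V:=R_CompleteNormedModule)).
intros t Ht. rewrite Rmin_left in Ht by lra. apply gamma_integrand_continuous. lra.
Qed.

Lemma gamma_partial_rec s a b : 0 < a -> a < b ->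
  s * gamma_partial s (a, b) = gamma_boundary s (a, b) + gamma_partial (s + 1) (a, b).
Proof.
intros Ha Hb. unfold gamma_partial, gamma_boundary; simpl.
assert (E : is_RInt (fun t => s * gamma_integrand s t - gamma_integrand (s + 1) t) a b
  (Rpower b s * exp (- b) - Rpower a s * exp (- a))).
{ apply (is_RInt_derive (V:=R_CompleteNormedModule) (fun t => Rpower t s * exp (- t)));
    intros t Ht; rewrite Rmin_left in Ht by lra.
  - unfold gamma_integrand, Rpower. auto_derive; [lra|].
    replace (s + 1 - 1) with s by ring.
    replace ((s - 1) * ln t) with (s * ln t + - ln t) by ring.
    rewrite exp_plus, (exp_Ropp (ln t)), exp_ln by lra. field. lra.
  - apply (continuous_minus (V:=R_NormedModule)); [|apply gamma_integrand_continuous; lra].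
    apply (continuous_scal_r (V:=R_NormedModule)), gamma_integrand_continuous. lra. }
assert (E' : is_RInt (fun t => s * gamma_integrand s t - gamma_integrand (s + 1) t) a b
  (s * RInt (gamma_integrand s) a b - RInt (gamma_integrand (s + 1)) a b)).
{ apply (is_RInt_minus (V:=R_NormedModule)); [apply (is_RInt_scal (V:=R_NormedModule))|];
    apply (RInt_correct (V:=R_CompleteNormedModule)), ex_RInt_gamma; assumption. }
apply (is_RInt_unique (V:=R_CompleteNormedModule)) in E.
apply (is_RInt_unique (V:=R_CompleteNormedModule)) in E'. simpl in E, E'. lra.
Qed.

(** Only the difference is claimed to converge, because neither truncated integral is known to do so
    yet; each integration by parts adds a vanishing boundary term. *)
Lemma gamma_partial_iter s n : 0 < s ->
  is_lim_0oo (fun ab => gamma_partial s ab - gamma_partial (s + INR n) ab / rising s n) 0.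
Proof.
intros Hs. induction n.
- apply is_lim_0oo_ext with (fun _ => 0); [|apply filterlim_const].
  intros a b _ _. simpl. rewrite Rplus_0_r. field.
- assert (P := rising_pos s n Hs). assert (Pn := pos_INR n).
  replace 0 with (0 + / rising s (S n) * 0) by ring.
  apply is_lim_0oo_ext with (2 := is_lim_0oo_plus _ _ _ _ IHn
    (is_lim_0oo_scal _ _ _ (gamma_boundary_cv (s + INR n) ltac:(lra)))).
  intros a b Ha Hb. cbv beta. cbn [rising].
  assert (E := gamma_partial_rec (s + INR n) a b Ha Hb).
  rewrite S_INR, <- Rplus_assoc.
  replace (gamma_partial (s + INR n + 1) (a, b))
    with ((s + INR n) * gamma_partial (s + INR n) (a, b) - gamma_boundary (s + INR n) (a, b)) by lra.
  field. lra.
Qed.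

(** Together with its converse below, it carries convergence from [1 <= s <= 2] to every [s > 0]. *)
Lemma gamma_partial_shift_up s l : 0 < s -> is_lim_0oo (gamma_partial s) l ->
  is_lim_0oo (gamma_partial (s + 1)) (s * l).
Proof.
intros Hs H. replace (s * l) with (s * l + -1 * 0) by ring.
apply is_lim_0oo_ext with (2 := is_lim_0oo_plus _ _ _ _ (is_lim_0oo_scal s _ _ H)
  (is_lim_0oo_scal (-1) _ _ (gamma_boundary_cv s Hs))).
intros a b Ha Hb. generalize (gamma_partial_rec s a b Ha Hb). lra.
Qed.

Lemma gamma_partial_shift_down s l : 0 < s -> is_lim_0oo (gamma_partial (s + 1)) (s * l) ->
  is_lim_0oo (gamma_partial s) l.
Proof.
intros Hs H. replace l with (/ s * (s * l) + / s * 0) by (field; lra).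
apply is_lim_0oo_ext with (2 := is_lim_0oo_plus _ _ _ _ (is_lim_0oo_scal (/ s) _ _ H)
  (is_lim_0oo_scal (/ s) _ _ (gamma_boundary_cv s Hs))).
intros a b Ha Hb. cbv beta.
rewrite <- Rmult_plus_distr_l, Rplus_comm, <- gamma_partial_rec by assumption. field. lra.
Qed.

(** Supplies the exact masses of the polynomial bounds in the squeeze, starting from the primitive
    [- exp (- t)]. *)
Lemma gamma_partial_fact n : is_lim_0oo (gamma_partial (INR n + 1)) (INR (fact n)).
Proof.
induction n.
- simpl INR. replace (0 + 1) with 1 by ring.
  replace 1 with (exp (- 0) + -1 * 0) at 2 by (rewrite Ropp_0, exp_0; ring).
  apply is_lim_0oo_ext with (fun ab => exp (- fst ab) + -1 * (Rpower (snd ab) 0 * exp (- snd ab))).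
  + intros a b Ha Hb. unfold gamma_partial; simpl. symmetry. apply is_RInt_unique.
    replace (exp (- a) + -1 * (Rpower b 0 * exp (- b))) with (- exp (- b) - - exp (- a))
      by (rewrite Rpower_O by lra; ring).
    apply is_RInt_ext with (fun t => exp (- t)).
    { intros t Ht. rewrite Rmin_left in Ht by lra. unfold gamma_integrand.
      rewrite Rminus_diag, Rpower_O by lra. eq_in_R. ring. }
    apply (is_RInt_derive (V:=R_CompleteNormedModule) (fun t => - exp (- t))); intros t Ht.
    * auto_derive; [exact I|ring].
    * apply (ex_derive_continuous (fun t => exp (- t))). auto_derive; exact I.
  + apply is_lim_0oo_plus.
    * apply (filterlim_comp _ _ _ fst (fun a => exp (- a)) _ _ _ filterlim_fst).
      apply filterlim_exp_opp_0.
    * apply is_lim_0oo_scal.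
      apply (filterlim_comp _ _ _ snd (fun b => Rpower b 0 * exp (- b)) _ _ _ filterlim_snd).
      apply filterlim_Rpower_exp_p.
- rewrite fact_simpl, mult_INR, S_INR. apply gamma_partial_shift_up; [|exact IHn].
  generalize (pos_INR n). lra.
Qed.

(** * Tangent inequalities for powers and the squeeze *)

Lemma ln_le_minus_1 x : 0 < x -> ln x <= x - 1.
Proof. intros Hx. generalize (exp_ineq1_le (ln x)). rewrite exp_ln by exact Hx. lra. Qed.

(** Weighted inequality of arithmetic and geometric means for [y] and [1]: the bounds
    [ln v <= v - 1] at [y / u] and [1 / u], weighted by [th] and [1 - th], add up to [0]. *)
Lemma Rpower_le_tangent y th : 0 < y -> 0 <= th <= 1 -> Rpower y th <= 1 + th * (y - 1).
Proof.
intros Hy Hth.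
set (u := 1 + th * (y - 1)).
assert (Hu : 0 < u) by (unfold u; nra).
assert (H1 := ln_le_minus_1 (y / u) ltac:(apply Rdiv_lt_0_compat; lra)).
assert (H2 := ln_le_minus_1 (1 / u) ltac:(apply Rdiv_lt_0_compat; lra)).
rewrite ln_div in H1, H2 by lra. rewrite ln_1 in H2.
assert (E : th * (y / u - 1) + (1 - th) * (1 / u - 1) = 0) by (unfold u; field; fold u; lra).
unfold Rpower. rewrite <- (exp_ln u) by exact Hu. apply exp_le_exp. nra.
Qed.

(** Bernoulli's inequality, obtained from the concave case with exponent [1 / s] at [v]; a
    nonpositive [v] is trivial. *)
Lemma Rpower_ge_tangent y s : 0 < y -> 1 <= s -> 1 + s * (y - 1) <= Rpower y s.
Proof.
intros Hy Hs. set (v := 1 + s * (y - 1)).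
destruct (Rle_lt_dec v 0) as [Hv|Hv]; [left; eapply Rle_lt_trans; [exact Hv|apply exp_pos]|].
assert (T := Rpower_le_tangent v (/ s) Hv).
replace (1 + / s * (v - 1)) with y in T by (unfold v; field; lra).
assert (I : 0 <= / s <= 1).
{ split; [left; apply Rinv_0_lt_compat; lra|]. rewrite <- Rinv_1. apply Rinv_le_contravar; lra. }
specialize (T I).
apply Rle_trans with (Rpower (Rpower v (/ s)) s).
- rewrite Rpower_mult. replace (/ s * s) with 1 by (field; lra). rewrite Rpower_1 by exact Hv. lra.
- apply Rle_Rpower_l; [lra|]. split; [apply exp_pos|exact T].
Qed.

(* For [y = t / n] and [1 <= s <= 2], [y^s] lies between two polynomials in [y] whose
   expectations under the density [t^n exp(-t) / n!] tend to [1]. *)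
Lemma gamma_integrand_bounds s n t : 1 <= s <= 2 -> (1 <= n)%nat -> 0 < t ->
  Rpower (INR n) s * ((1 - s) * gamma_integrand (INR n + 1) t
     + s / INR n * gamma_integrand (INR (S n) + 1) t) <= gamma_integrand (s + INR (S n)) t
  <= Rpower (INR n) s * ((2 - s) / INR n * gamma_integrand (INR (S n) + 1) t
     + (s - 1) / INR n ^ 2 * gamma_integrand (INR (S (S n)) + 1) t).
Proof.
intros Hs Hn Ht.
assert (Pn : 0 < INR n) by (apply lt_0_INR; lia).
assert (G : forall k, gamma_integrand (INR k + 1) t = t ^ k * exp (- t)).
{ intros k. unfold gamma_integrand. replace (INR k + 1 - 1) with (INR k) by ring.
  rewrite Rpower_pow by exact Ht. reflexivity. }
rewrite !G.
set (y := t / INR n).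
assert (Hy : 0 < y) by (apply Rdiv_lt_0_compat; assumption).
assert (E : gamma_integrand (s + INR (S n)) t
  = (Rpower (INR n) s * (t ^ n * exp (- t))) * Rpower y s).
{ unfold gamma_integrand. rewrite S_INR.
  replace (s + (INR n + 1) - 1) with (s + INR n) by ring.
  rewrite Rpower_plus, Rpower_pow by exact Ht.
  replace (Rpower t s) with (Rpower (INR n) s * Rpower y s); [ring|].
  rewrite Rpower_mult_distr by assumption. f_equal. unfold y. field. lra. }
assert (W : 0 <= Rpower (INR n) s * (t ^ n * exp (- t))).
{ apply Rmult_le_pos; [left; apply exp_pos|].
  apply Rmult_le_pos; [apply pow_le; lra|left; apply exp_pos]. }
assert (L := Rpower_ge_tangent y s Hy ltac:(lra)).
(* Splitting off one factor [y] leaves the exponent [s - 1] in [[0, 1]], where the tangent bounds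
   from above. *)
assert (U : Rpower y s <= y * (1 + (s - 1) * (y - 1))).
{ replace s with (1 + (s - 1)) at 1 by ring. rewrite Rpower_plus, Rpower_1 by exact Hy.
  apply Rmult_le_compat_l; [lra|]. apply Rpower_le_tangent; lra. }
rewrite E. split.
- replace (Rpower (INR n) s * ((1 - s) * (t ^ n * exp (- t)) + s / INR n * (t ^ S n * exp (- t))))
    with (Rpower (INR n) s * (t ^ n * exp (- t)) * (1 + s * (y - 1)))
    by (unfold y; simpl; field; lra).
  apply Rmult_le_compat_l; assumption.
- replace (Rpower (INR n) s * ((2 - s) / INR n * (t ^ S n * exp (- t))
      + (s - 1) / INR n ^ 2 * (t ^ S (S n) * exp (- t))))
    with (Rpower (INR n) s * (t ^ n * exp (- t)) * (y * (1 + (s - 1) * (y - 1))))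
    by (unfold y; simpl; field; lra).
  apply Rmult_le_compat_l; assumption.
Qed.

Lemma is_RInt_gamma_lincomb c d e s s' a b : 0 < a -> a < b ->
  is_RInt (fun t => c * (d * gamma_integrand s t + e * gamma_integrand s' t)) a b
   (c * (d * gamma_partial s (a, b) + e * gamma_partial s' (a, b))).
Proof.
intros Ha Hb. apply (is_RInt_scal (V:=R_NormedModule)), (is_RInt_plus (V:=R_NormedModule));
  apply (is_RInt_scal (V:=R_NormedModule));
  apply (RInt_correct (V:=R_CompleteNormedModule)), ex_RInt_gamma; assumption.
Qed.

Lemma gamma_partial_bounds s n a b : 1 <= s <= 2 -> (1 <= n)%nat -> 0 < a -> a < b ->
  Rpower (INR n) s * ((1 - s) * gamma_partial (INR n + 1) (a, b)
     + s / INR n * gamma_partial (INR (S n) + 1) (a, b)) <= gamma_partial (s + INR (S n)) (a, b)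
  <= Rpower (INR n) s * ((2 - s) / INR n * gamma_partial (INR (S n) + 1) (a, b)
     + (s - 1) / INR n ^ 2 * gamma_partial (INR (S (S n)) + 1) (a, b)).
Proof.
intros Hs Hn Ha Hb.
assert (I : is_RInt (gamma_integrand (s + INR (S n))) a b (gamma_partial (s + INR (S n)) (a, b)))
  by (apply (RInt_correct (V:=R_CompleteNormedModule)), ex_RInt_gamma; assumption).
split.
- apply is_RInt_le with (2 := is_RInt_gamma_lincomb _ _ _ _ _ a b Ha Hb) (3 := I); [lra|].
  intros t Ht. apply gamma_integrand_bounds; try assumption. lra.
- apply is_RInt_le with (2 := I) (3 := is_RInt_gamma_lincomb _ _ _ _ _ a b Ha Hb); [lra|].
  intros t Ht. apply gamma_integrand_bounds; try assumption. lra.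
Qed.

(** The bounds may depend on [eps] and need only have limits close to [l], which fits polynomial
    bounds indexed by [n]. *)
Lemma is_lim_0oo_squeeze f l :
  (forall eps, 0 < eps -> exists u v lu lv, is_lim_0oo u lu /\ is_lim_0oo v lv /\
     l - eps < lu /\ lv < l + eps /\
     forall a b, 0 < a -> a < b -> u (a, b) <= f (a, b) <= v (a, b)) ->
  is_lim_0oo f l.
Proof.
intros H. apply is_lim_0oo_eps. intros eps.
destruct (H (eps / 2)) as [u [v [lu [lv [Hu [Hv [L [U B]]]]]]]]; [apply is_pos_div_2|].
destruct eps as [eps He]; simpl in *.
assert (He2 : 0 < eps / 2) by lra.
apply is_lim_0oo_eps with (eps := mkposreal _ He2) in Hu.
apply is_lim_0oo_eps with (eps := mkposreal _ He2) in Hv.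
apply zero_infty_imp with
  (2 := zero_infty_and _ _ zero_infty_ordered (zero_infty_and _ _ Hu Hv)).
simpl. intros [a b] [[Ha Hb] [h1 h2]]. simpl in Ha, Hb.
apply Rabs_lt_between in h1. apply Rabs_lt_between in h2.
generalize (B a b Ha Hb). intros. apply Rabs_lt_between. lra.
Qed.

Lemma gamma_partial_cv_1_2 s : 1 <= s <= 2 ->
  is_lim_0oo (gamma_partial s) (Re (CGamma s)).
Proof.
intros Hs. destruct (gauss_seq_R_cv s ltac:(lra)) as [_ G].
set (l := Re (CGamma s)) in *.
(* The extra factors here and in [UU] are the expectations of the bounds for [y^s], as [y] has mean
   [(n+1)/n] and [y^2] has mean [(n+1)(n+2)/n^2]. *)
assert (LL : is_lim_seq (fun n => gauss_seq_R s n * (1 + s / INR n)) l).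
{ replace (Finite l) with (Finite (l * (1 + 0))) by (f_equal; ring).
  apply is_lim_seq_mult'; [exact G|].
  apply is_lim_seq_plus'; [apply is_lim_seq_const|apply is_lim_seq_div_INR]. }
assert (UU : is_lim_seq (fun n => gauss_seq_R s n *
   ((2 - s) * (1 + 1 / INR n) + (s - 1) * ((1 + 1 / INR n) * (1 + 2 / INR n)))) l).
{ replace (Finite l) with (Finite (l * ((2 - s) * (1 + 0) + (s - 1) * ((1 + 0) * (1 + 0)))))
    by (f_equal; ring).
  apply is_lim_seq_mult'; [exact G|].
  repeat first [apply is_lim_seq_const|apply is_lim_seq_div_INR
    |apply is_lim_seq_plus'|apply is_lim_seq_mult']. }
apply is_lim_0oo_squeeze. intros eps He.
apply is_lim_seq_spec in LL. apply is_lim_seq_spec in UU.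
assert (X : exists n, (1 <= n)%nat /\ Rabs (gauss_seq_R s n * (1 + s / INR n) - l) < eps /\
  Rabs (gauss_seq_R s n *
   ((2 - s) * (1 + 1 / INR n) + (s - 1) * ((1 + 1 / INR n) * (1 + 2 / INR n))) - l) < eps).
{ destruct (LL (mkposreal _ He)) as [N1 L1]. destruct (UU (mkposreal _ He)) as [N2 U2].
  exists (S (max N1 N2)). split; [lia|split]; [apply L1|apply U2]; lia. }
destruct X as [n [Hn [L1 U2]]].
apply Rabs_lt_between in L1. apply Rabs_lt_between in U2.
assert (Pn : 0 < INR n) by (apply lt_0_INR; lia).
assert (Q := rising_pos s (S n) ltac:(lra)).
set (D := fun ab => gamma_partial s ab - gamma_partial (s + INR (S n)) ab / rising s (S n)).
assert (HD : is_lim_0oo D 0) by (apply gamma_partial_iter; lra).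
set (c := / rising s (S n) * Rpower (INR n) s).
exists (fun ab => D ab + c * ((1 - s) * gamma_partial (INR n + 1) ab
     + s / INR n * gamma_partial (INR (S n) + 1) ab)).
exists (fun ab => D ab + c * ((2 - s) / INR n * gamma_partial (INR (S n) + 1) ab
     + (s - 1) / INR n ^ 2 * gamma_partial (INR (S (S n)) + 1) ab)).
exists (0 + c * ((1 - s) * INR (fact n) + s / INR n * INR (fact (S n)))).
exists (0 + c * ((2 - s) / INR n * INR (fact (S n)) + (s - 1) / INR n ^ 2 * INR (fact (S (S n))))).
split; [|split; [|split; [|split]]].
- apply is_lim_0oo_plus; [exact HD|]. apply is_lim_0oo_scal, is_lim_0oo_plus;
    apply is_lim_0oo_scal, gamma_partial_fact.
- apply is_lim_0oo_plus; [exact HD|]. apply is_lim_0oo_scal, is_lim_0oo_plus;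
    apply is_lim_0oo_scal, gamma_partial_fact.
- replace (0 + _) with (gauss_seq_R s n * (1 + s / INR n)); [lra|].
  unfold gauss_seq_R, c. rewrite fact_simpl, mult_INR, S_INR. field. lra.
- replace (0 + _) with (gauss_seq_R s n * ((2 - s) * (1 + 1 / INR n) + (s - 1) * ((1 + 1 / INR n) * (1 + 2 / INR n)))); [lra|].
  unfold gauss_seq_R, c. rewrite !fact_simpl, !mult_INR, !S_INR. field. lra.
- intros a b Ha Hb. destruct (gamma_partial_bounds s n a b Hs Hn Ha Hb) as [B1 B2].
  assert (I : 0 <= / rising s (S n)) by (left; apply Rinv_0_lt_compat, Q).
  apply (Rmult_le_compat_l _ _ _ I) in B1. apply (Rmult_le_compat_l _ _ _ I) in B2.
  unfold D, c, Rdiv in *. lra.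
Qed.

Lemma Re_CGamma_shift s : 0 < s -> Re (CGamma (s + 1)%R) = s * Re (CGamma s).
Proof.
intros Hs. rewrite RtoC_plus, CGamma_shift by (apply not_pole_Re_pos, Hs).
apply re_scal_l.
Qed.

(** Induction on an integer bound for [s] climbs by unit shifts; arguments below [1] are reached by
    one shift down. *)
Lemma gamma_partial_cv s : 0 < s -> is_lim_0oo (gamma_partial s) (Re (CGamma s)).
Proof.
intros Hs0.
assert (P : forall N s, 0 < s -> s <= INR N + 2 -> is_lim_0oo (gamma_partial s) (Re (CGamma s))).
{ clear s Hs0. induction N; intros s Hs HN.
  - simpl in HN. destruct (Rle_lt_dec 1 s) as [h|h]; [apply gamma_partial_cv_1_2; lra|].
    apply gamma_partial_shift_down; [exact Hs|]. rewrite <- Re_CGamma_shift by exact Hs.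
    apply gamma_partial_cv_1_2; lra.
  - rewrite S_INR in HN. destruct (Rle_lt_dec s (INR N + 2)) as [h|h]; [apply IHN; assumption|].
    assert (PN := pos_INR N).
    replace s with (s - 1 + 1) by ring. rewrite Re_CGamma_shift by lra.
    apply gamma_partial_shift_up; [lra|]. apply IHN; lra. }
destruct (exists_nat_ge s) as [N [_ HN]]. apply (P N); lra.
Qed.

End EulerIntegral.

Lemma CGamma_Euler (s : R) : (0 < s)%R -> CGamma s = Gamma s.
Proof.
intros Hs. destruct (gauss_seq_R_cv s Hs) as [E _]. rewrite E. f_equal.
symmetry. unfold Gamma.
refine (is_RInt_gen_unique (V:=R_CompleteNormedModule) (gamma_integrand s) _ _).
intros P HP.
apply zero_infty_imp with
  (2 := zero_infty_and _ _ zero_infty_ordered (gamma_partial_cv s Hs P HP)).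
intros [a b] [[Ha Hb] h]. exists (gamma_partial s (a, b)). split; [|exact h].
apply (RInt_correct (V:=R_CompleteNormedModule)), ex_RInt_gamma; assumption.
Qed.

(** * The p-k Gamma function *)

Section PKGamma.

Context (k p : R) (Hk : (0 < k)%R) (Hp : (0 < p)%R).

Let Nk : RtoC k <> 0.
Proof. apply RtoC_neq_0. lra. Qed.

Let Np : RtoC p <> 0.
Proof. apply RtoC_neq_0. lra. Qed.

Lemma not_pole_div z : pk_Gamma_dom k z -> not_pole (z / k).
Proof.
intros H j E. apply (H j). replace z with (z / k * k) by (field; exact Nk). rewrite E. ring.
Qed.

(** Each factor is [p (z/k + i)], so [p^(n+1)] cancels. At [n = 0] the base [n p] would not be
    positive and its power would not split. *)
Lemma pk_Gamma_seq_gauss z n : (1 <= n)%nat -> pk_Gamma_dom k z ->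
  pk_Gamma_seq p k z n = Cpower p (z / k) * gauss_seq (z / k) n.
Proof.
intros Hn Hz. apply not_pole_div in Hz.
unfold pk_Gamma_seq, gauss_seq, pk_pochhammer.
replace (n + 1)%nat with (S n) by lia.
rewrite Cpower_mult_base by (try (apply lt_0_INR; lia); exact Hp).
rewrite (Cprod_ext (fun i => z * p / k + INR i * p) (fun i => p * (z / k + INR i)))
  by (intros; field; exact Nk).
rewrite Cprod_scal, RtoC_pow. field. repeat split;
  first [apply Cpow_nz, Np|apply Cprod_neq_0; intros; apply not_pole_neq_0, Hz].
Qed.

Lemma pk_Gamma_CGamma z : pk_Gamma_dom k z ->
  pk_Gamma p k z = Cpower p (z / k) / k * CGamma (z / k).
Proof.
intros Hz. unfold pk_Gamma.
rewrite (Clim_seq_unique _ (Cpower p (z / k) * CGamma (z / k))); [field; exact Nk|].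
eapply is_Clim_ext_from with (N := 1%nat).
- intros n Hn. symmetry. apply pk_Gamma_seq_gauss; assumption.
- apply is_Clim_mult; [apply is_Clim_const|]. apply is_Clim_gauss_seq, not_pole_div, Hz.
Qed.

Lemma pk_Gamma_neq_0 z : pk_Gamma_dom k z -> pk_Gamma p k z <> 0.
Proof.
intros Hz. rewrite pk_Gamma_CGamma by exact Hz.
apply Cmult_neq_0; [apply Cmult_neq_0|].
- apply Cpower_neq_0.
- apply Cinv_neq_0, Nk.
- apply CGamma_neq_0, not_pole_div, Hz.
Qed.

Lemma pk_Gamma_dom_shift z n : pk_Gamma_dom k z -> pk_Gamma_dom k (z + INR n * k).
Proof.
intros H j E. apply (H (n + j)%nat). rewrite plus_INR, RtoC_plus.
replace z with (z + INR n * k - INR n * k) by ring. rewrite E. ring.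
Qed.

Lemma pk_Gamma_shift_INR z n : pk_Gamma_dom k z ->
  pk_Gamma p k (z + INR n * k)
  = (p ^ n)%R * Cprod (fun i => z / k + INR i) n * pk_Gamma p k z.
Proof.
intros Hz. rewrite !pk_Gamma_CGamma by (try apply pk_Gamma_dom_shift; exact Hz).
replace ((z + INR n * k) / k) with (z / k + INR n) by (field; exact Nk).
rewrite CGamma_shift_INR by (apply not_pole_div, Hz).
rewrite Cpower_plus, Cpower_INR by exact Hp. field. exact Nk.
Qed.

(** Forward shift from [z - n k], with the factors read in reverse order. *)
Lemma pk_Gamma_quotient_backward z n : pk_Gamma_dom k (z - INR n * k) ->
  pk_Gamma p k z / pk_Gamma p k (z - INR n * k)
  = (p ^ n)%R / (k ^ n)%R * Cprod (fun i => z - INR (i + 1) * k) n.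
Proof.
intros Hz. replace z with (z - INR n * k + INR n * k) at 1 by ring.
rewrite pk_Gamma_shift_INR by exact Hz.
rewrite Cprod_rev.
rewrite (Cprod_ext (fun i => z - INR (i + 1) * k)
  (fun i => k * ((z - INR n * k) / k + INR (n - 1 - i)))).
- rewrite Cprod_scal, !RtoC_pow. field.
  split; first [apply pk_Gamma_neq_0, Hz|apply Cpow_nz, Nk].
- intros i Hi. rewrite !minus_INR, plus_INR, !RtoC_minus, RtoC_plus by lia.
  simpl. field. exact Nk.
Qed.

Lemma pk_Gamma_Gamma (s : R) : (0 < s)%R ->
  pk_Gamma p k s = (Rpower p (s / k) / k * Gamma (s / k))%R.
Proof.
intros Hs. rewrite pk_Gamma_CGamma.
- rewrite <- RtoC_div, Cpower_RtoC, CGamma_Euler, RtoC_mult, RtoC_div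
    by first [lra|apply Rdiv_lt_0_compat; assumption].
  reflexivity.
- intros j E. rewrite <- RtoC_mult, <- RtoC_opp in E. apply RtoC_inj in E.
  generalize (pos_INR j). nra.
Qed.

Lemma pk_Gamma_reflection z : pk_Gamma_dom k z -> pk_Gamma_dom k (k - z) ->
  pk_Gamma p k z * pk_Gamma p k (k - z) = (p / k ^ 2)%R * (PI / Csin (PI * z / k)).
Proof.
intros Hz Hz'. rewrite !pk_Gamma_CGamma by assumption.
assert (E : (k - z) / k = 1 - z / k) by (field; exact Nk).
assert (H' := not_pole_div _ Hz'). rewrite E in *.
assert (R := CGamma_reflection (z / k) (not_pole_div _ Hz) H').
replace (PI * (z / k)) with (PI * z / k) in R by (field; exact Nk).
assert (NPI : RtoC PI <> 0) by (apply RtoC_neq_0, PI_neq0).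
(* A zero of the sine would turn the reflection formula into [0 = PI]. *)
assert (NS : Csin (PI * z / k) <> 0) by (intros S; apply NPI; rewrite <- R, S; ring).
set (q := Csin (PI * z / k)) in *. rewrite <- R, Cpower_minus, Cpower_1 by exact Hp.
rewrite RtoC_div, RtoC_pow by (apply pow_nonzero; lra).
assert (Np' := Cpower_neq_0 p (z / k)).
field. auto.
Qed.

(** The offsets [r/m] add up to [(m - 1)/2], the exponent of [p]; of the [m] factors [1/k], one is
    absorbed by the Gamma value at [m z]. *)
Lemma pk_Gamma_multiplication z m : (1 <= m)%nat ->
  (forall r, (r < m)%nat -> pk_Gamma_dom k (z + k * INR r / INR m)) ->
  pk_Gamma_dom k (INR m * z) ->
  Cprod (fun r => pk_Gamma p k (z + k * INR r / INR m)) m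
  = (Rpower p ((INR m - 1) / 2) / k ^ (m - 1))%R
    * Rpower (2 * PI) ((INR m - 1) / 2)
    * Cpower (INR m) (1 / 2 - INR m * z / k)
    * pk_Gamma p k (INR m * z).
Proof.
intros Hm Hz Hmz.
assert (Nm : RtoC (INR m) <> 0) by (apply RtoC_neq_0, not_0_INR; lia).
assert (D : forall r, (z + k * INR r / INR m) / k = z / k + INR r / INR m)
  by (intros; field; auto).
assert (Em : INR m * z / k = INR m * (z / k)) by (field; exact Nk).
rewrite (Cprod_ext _ (fun r => (/ k * Cpower p (z / k + INR r * / INR m)) * CGamma (z / k + INR r / INR m))).
2:{ intros r Hr. rewrite pk_Gamma_CGamma, D by auto. unfold Cdiv. ring. }
rewrite Cprod_mult, Cprod_scal, Cprod_Cpower_arith.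
rewrite CGamma_multiplication, pk_Gamma_CGamma, Em.
- rewrite Cpower_plus.
  replace (/ INR m * (INR m * (INR m - 1) / 2)) with (RtoC ((INR m - 1) / 2))
    by (rewrite RtoC_div, RtoC_minus by lra; field; exact Nm).
  rewrite Cpower_RtoC, RtoC_div by (apply pow_nonzero; lra).
  rewrite RtoC_pow, Cpow_inv by exact Nk.
  replace m with (S (m - 1)) at 1 by lia. rewrite Cpow_S.
  field. repeat split; first [exact Nk|apply Cpow_nz, Nk].
- exact Hmz.
- exact Hm.
- intros r Hr. rewrite <- D. apply not_pole_div, Hz, Hr.
- rewrite <- Em. apply not_pole_div, Hmz.
Qed.

End PKGamma.

Theorem theorem2p11 :
  forall (k p : R) (n : nat) (x : C),
    (0 < k)%R -> (0 < p)%R -> (1 <= n)%nat ->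
    (forall j : nat, (1 <= j)%nat -> x <> - (INR j * k)) ->
    (0 < Re x)%R ->
    (pk_Gamma_dom k (x + INR n * k) -> pk_Gamma_dom k x ->
       pk_pochhammer p k x n
       = pk_Gamma p k (x + INR n * k) / pk_Gamma p k x)
    /\
    (pk_Gamma_dom k (x + k) -> pk_Gamma_dom k x ->
       pk_Gamma p k (x + k) = x * p / k * pk_Gamma p k x)
    /\
    (pk_Gamma_dom k (x + INR n * k) -> pk_Gamma_dom k x ->
       pk_Gamma p k (x + INR n * k)
       = (p ^ n)%R * Cprod (fun i => x / k + INR i) n * pk_Gamma p k x)
    /\
    (pk_Gamma_dom k x -> pk_Gamma_dom k (x - INR n * k) ->
       pk_Gamma p k x / pk_Gamma p k (x - INR n * k)
       = (p ^ n)%R / (k ^ n)%R * Cprod (fun i => x - INR (i + 1) * k) n)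
    /\
    (pk_Gamma_dom k x -> pk_Gamma_dom k (x - INR n * k) ->
     pk_Gamma_dom k (- x + INR n * k + k) -> pk_Gamma_dom k (- x + k) ->
       pk_Gamma p k x / pk_Gamma p k (x - INR n * k)
       = ((-1) ^ n)%R
         * (pk_Gamma p k (- x + INR n * k + k) / pk_Gamma p k (- x + k)))
    /\
    pk_Gamma p k 1 = (Rpower p (1 / k) / k * Gamma (1 / k))%R
    /\
    pk_Gamma p k k = p / k
    /\
    pk_Gamma p k p = (Rpower p (p / k) / k * Gamma (p / k))%R
    /\
    (pk_Gamma_dom k x -> pk_Gamma_dom k (- x) ->
       pk_Gamma p k x * pk_Gamma p k (- x)
       = - (PI / (x * k)) * (1 / Csin (PI * x / k)))
    /\
    (pk_Gamma_dom k x -> pk_Gamma_dom k (k - x) ->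
       pk_Gamma p k x * pk_Gamma p k (k - x)
       = (p / k ^ 2)%R * (PI / Csin (PI * x / k)))
    /\
    (forall m : nat, (2 <= m)%nat ->
       (forall r : nat, (r < m)%nat ->
          pk_Gamma_dom k (x + k * INR r / INR m)) ->
       pk_Gamma_dom k (INR m * x) ->
       Cprod (fun r => pk_Gamma p k (x + k * INR r / INR m)) m
       = (Rpower p ((INR m - 1) / 2) / k ^ (m - 1))%R
         * Rpower (2 * PI) ((INR m - 1) / 2)
         * Cpower (INR m) (1 / 2 - INR m * x / k)
         * pk_Gamma p k (INR m * x)).
Proof.
intros k p n x Hk Hp Hn _ Hre.
assert (Nk : RtoC k <> 0) by (apply RtoC_neq_0; lra).
assert (Np : RtoC p <> 0) by (apply RtoC_neq_0; lra).
assert (Nx : x <> 0) by (intros ->; simpl in Hre; lra).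
split; [|split; [|split; [|split; [|split; [|split; [|split; [|split; [|split; [|split]]]]]]]]].
- intros _ Hx. rewrite pk_Gamma_shift_INR by assumption.
  unfold pk_pochhammer.
  rewrite (Cprod_ext _ (fun i => p * (x / k + INR i))) by (intros; field; exact Nk).
  rewrite Cprod_scal, RtoC_pow. field. apply pk_Gamma_neq_0; assumption.
- intros _ Hx.
  replace (x + k) with (x + INR 1 * k) by (simpl; ring).
  rewrite pk_Gamma_shift_INR by assumption. simpl. rewrite Rmult_1_r. field. exact Nk.
- intros _ Hx. apply pk_Gamma_shift_INR; assumption.
- intros _ Hxn. rewrite (pk_Gamma_quotient_backward k p Hk Hp) by assumption. reflexivity.
- intros _ Hxn Hr1 Hr2.
  rewrite (pk_Gamma_quotient_backward k p Hk Hp) by assumption.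
  replace (- x + INR n * k + k) with ((- x + k) + INR n * k) by ring.
  rewrite pk_Gamma_shift_INR by assumption.
  (* Extracting [- k] from every factor gives the sign [(-1)^n] and leaves the rising product of the
     forward shift from [- x + k]. *)
  rewrite (Cprod_ext (fun i => x - INR (i + 1) * k) (fun i => - k * ((- x + k) / k + INR i))).
  2:{ intros. rewrite plus_INR, RtoC_plus. simpl. field. exact Nk. }
  rewrite Cprod_scal.
  replace (- k) with ((-1)%R * k) by (apply C_eq; simpl; ring).
  rewrite Cpow_mult_l, !RtoC_pow.
  field. split; first [apply pk_Gamma_neq_0; assumption|apply Cpow_nz, Nk].
- apply pk_Gamma_Gamma; lra.
- rewrite pk_Gamma_CGamma; try assumption.
  + replace (RtoC k / k) with (RtoC 1) by (field; exact Nk).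
    rewrite Cpower_1, CGamma_1 by assumption. ring.
  + intros j E. rewrite <- RtoC_mult, <- RtoC_opp in E. apply RtoC_inj in E.
    generalize (pos_INR j). nra.
- apply pk_Gamma_Gamma; assumption.
- intros Hx Hx'.
  assert (Hkx : pk_Gamma_dom k (k - x)).
  { replace (k - x) with (- x + INR 1 * k) by (simpl; ring).
    apply pk_Gamma_dom_shift; assumption. }
  assert (R := pk_Gamma_reflection k p Hk Hp x Hx Hkx).
  replace (k - x) with (- x + INR 1 * k) in R by (simpl; ring).
  rewrite pk_Gamma_shift_INR in R by assumption. simpl in R.
  (* One shift gives the value at [k - x] as [- x p / k] times the value at [- x]; the factor in
     front inverts this. *)
  replace (pk_Gamma p k x * pk_Gamma p k (- x))
    with (- k / (p * x) * ((p / k ^ 2)%R * (PI / Csin (PI * x / k)))).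
  + rewrite RtoC_div, RtoC_pow by (apply pow_nonzero; lra).
    (* With the inverse of the sine opaque, [field] does not ask for the sine to be nonzero. *)
    unfold Cdiv. set (q := / Csin (PI * x * / k)). field. auto.
  + simpl. rewrite <- R, Rmult_1_r. field. auto.
- intros. apply pk_Gamma_reflection; assumption.
- intros m Hm. apply pk_Gamma_multiplication; first [assumption|lia].
Qed.
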